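(* Let $n=qp+r$ with integers $q\ge 0$ and $0\leq r<p$. As $G$-modules, $$(D^n)^{G_1} \cong \begin{cases} k & \text{if } n\leq p-3 \text{ is even,} \\ (D^q)^F & \text{if } r=p-1,\\ (D^{q-1})^F & \text{if } r \text{ is odd,} \\ (D^{q-2})^F & \text{if } r<p-1 \text{ is even and } q\ge 1, \end{cases}$$ where $D^m=0$ for $m<0$.
   Context: $k$ is a field of characteristic $p>2$; $\mathfrak g=\mathfrak{sl}_2(k)$; $G=\mathsf{SL}_2$ as an algebraic group over $k$, $G_1$ is its first Frobenius kernel, and $M^F$ denotes the first Frobenius twist of a $G$-module $M$. The $G_1$-invariants of a $G$-module form a $G$-submodule. For a $k$-vector space $V$ with basis $v_1,\dots,v_d$, the divided power algebra $D(V)$ is the commutative algebra with basis $v_1^{(a_1)}\cdots v_d^{(a_d)}$ ($a_i\ge0$) and multiplication determined by $v^{(a)}v^{(b)}=\binom{a+b}{a}v^{(a+b)}$; it is graded with $v_1^{(a_1)}\cdots v_d^{(a_d)}$ in degree $\sum a_i$. It is identified with the graded dual $\bigoplus_n S^n(V^* )^*$ of the symmetric algebra $S(V^* )$, where $S(V^* )$ has the coalgebra structure with $v\mapsto v\otimes1+1\otimes v$ for $v\in V^*$; via this identification a $G$-action on $V$ gives a $G$-action on $D(V)$ by graded algebra automorphisms. Write $D=D(\mathfrak g)$ and $D^n=D^n(\mathfrak g)$ for its degree $n$ part, where $G$ acts on $\mathfrak g$ by the adjoint action. *)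

(* Defs.v *)
From HB Require Import structures.
From mathcomp Require Import all_boot all_order all_algebra.
From mathcomp Require Import mpoly.

Set Implicit Arguments.
Unset Strict Implicit.
Unset Printing Implicit Defensive.

Import GRing.Theory.
Local Open Scope ring_scope.

(* The group schemes SL_2 and its first Frobenius kernel G_1 are given by their
   functors of points on commutative k-algebras R. *)
Definition SL2 (R : comNzRingType) (g : 'M[R]_2) : Prop := \det g = 1.

(* F : SL_2 -> SL_2 is the k-endomorphism raising matrix entries to the power p
   (SL_2 is defined over the prime field). *)
Definition frob (p : nat) (R : comNzRingType) (g : 'M[R]_2) : 'M[R]_2 :=
  map_mx (fun x => x ^+ p) g.

Definition G1 (p : nat) (R : comNzRingType) (g : 'M[R]_2) : Prop :=
  SL2 g /\ frob p g = 1%:M.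

(* v (x) 1, for v in M = k^m, as an element of M (x)_k R = R^m *)
Definition base_change (k : fieldType) (R : comAlgType k) (m n : nat)
  (A : 'M[k]_(m, n)) : 'M[R]_(m, n) := map_mx (GRing.in_alg R) A.

(* A finite-dimensional G-module with a chosen k-basis: a homomorphism of
   k-group functors SL_2 -> GL_d. Vectors are columns, G acts on the left.
   The values of gact outside SL_2(R) are irrelevant. *)
Record gmodule (k : fieldType) := GModule {
  gdim : nat;
  gact : forall R : comAlgType k, 'M[R]_2 -> 'M[R]_gdim;
  gact1 : forall R : comAlgType k, gact (1%:M : 'M[R]_2) = 1%:M;
  gactM : forall (R : comAlgType k) (g h : 'M[R]_2), SL2 g -> SL2 h ->
    gact (g *m h) = gact g *m gact h;
  gact_natural : forall (R S : comAlgType k) (f : {lrmorphism R -> S})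
    (g : 'M[R]_2), SL2 g -> gact (map_mx f g) = map_mx f (gact g)
}.

Definition G1_invariant (k : fieldType) (p : nat) (M : gmodule k)
  (v : 'cV[k]_(gdim M)) : Prop :=
  forall (R : comAlgType k) (g : 'M[R]_2), G1 p g ->
    gact M g *m base_change R v = base_change R v.

Definition equivariant (k : fieldType) (M N : gmodule k)
  (f : 'M[k]_(gdim N, gdim M)) : Prop :=
  forall (R : comAlgType k) (g : 'M[R]_2), SL2 g ->
    base_change R f *m gact M g = gact N g *m base_change R f.

(* M^{G_1} ~= N as G-modules. The isomorphism is presented as the composite
   f : N ~= M^{G_1} -> M with the inclusion; as - (x)_k R is exact, f is
   G-equivariant into M iff it is so into the submodule M^{G_1}. *)
Definition G1_invariants_iso (k : fieldType) (p : nat) (M N : gmodule k) : Prop :=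
  exists f : 'M[k]_(gdim M, gdim N),
    [/\ equivariant f,
        injective (fun u : 'cV[k]_(gdim N) => f *m u) &
        forall v : 'cV[k]_(gdim M),
          G1_invariant p v <-> exists u : 'cV[k]_(gdim N), v = f *m u].

Section Trivial.
Variables (k : fieldType) (d : nat).

Definition triv_act (R : comAlgType k) (g : 'M[R]_2) : 'M[R]_d := 1%:M.

Fact triv_act1 (R : comAlgType k) : triv_act (1%:M : 'M[R]_2) = 1%:M.
Proof. by []. Qed.

Fact triv_actM (R : comAlgType k) (g h : 'M[R]_2) : SL2 g -> SL2 h ->
  triv_act (g *m h) = triv_act g *m triv_act h.
Proof. by rewrite mulmx1. Qed.

Fact triv_act_natural (R S : comAlgType k) (f : {lrmorphism R -> S})
  (g : 'M[R]_2) : SL2 g -> triv_act (map_mx f g) = map_mx f (triv_act g).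
Proof. by rewrite map_mx1. Qed.

Definition gtriv : gmodule k := GModule triv_act1 triv_actM triv_act_natural.
End Trivial.

Section Twist.
Variables (k : fieldType) (p : nat) (M : gmodule k).
Hypothesis charp : p \in [pchar k].

Let charR (R : comAlgType k) : p \in [pchar R].
Proof. exact: rmorph_pchar (GRing.in_alg R) _ charp. Qed.

Let frobE (R : comAlgType k) (g : 'M[R]_2) :
  frob p g = map_mx (pFrobenius_aut (charR R)) g.
Proof. by apply/matrixP => i j; rewrite !mxE. Qed.

Let frob_SL2 (R : comAlgType k) (g : 'M[R]_2) : SL2 g -> SL2 (frob p g).
Proof. by rewrite /SL2 frobE det_map_mx => ->; rewrite rmorph1. Qed.

Definition twist_act (R : comAlgType k) (g : 'M[R]_2) : 'M[R]_(gdim M) :=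
  gact M (frob p g).

Fact twist_act1 (R : comAlgType k) : twist_act (1%:M : 'M[R]_2) = 1%:M.
Proof. by rewrite /twist_act frobE map_mx1 gact1. Qed.

Fact twist_actM (R : comAlgType k) (g h : 'M[R]_2) : SL2 g -> SL2 h ->
  twist_act (g *m h) = twist_act g *m twist_act h.
Proof.
move=> Hg Hh; rewrite /twist_act -gactM; try exact: frob_SL2.
by rewrite !frobE map_mxM.
Qed.

Fact twist_act_natural (R S : comAlgType k) (f : {lrmorphism R -> S})
  (g : 'M[R]_2) : SL2 g -> twist_act (map_mx f g) = map_mx f (twist_act g).
Proof.
move=> Hg; rewrite /twist_act -gact_natural; last exact: frob_SL2.
by congr gact; apply/matrixP => i j; rewrite !mxE rmorphXn.
Qed.

Definition gtwist : gmodule k :=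
  GModule twist_act1 twist_actM twist_act_natural.
End Twist.

(* D^n(V), realized as the dual of S^n(V^* ), where S(V^* ) = k[x_1,...,x_d] is
   the ring of polynomial functions on V. The dual basis of the monomials x^a of
   degree n is the basis v^(a) = v_1^(a_1) ... v_d^(a_d) of D^n(V). *)
Section DividedPower.
Variables (k : fieldType).

(* f |-> f o A, for f a polynomial function on R^d and A : R^d -> R^d *)
Definition mpoly_comp_mx (R : comNzRingType) (d : nat) (A : 'M[R]_d)
  (f : {mpoly R[d]}) : {mpoly R[d]} :=
  f \mPo [tuple \sum_(i < d) A j i *: 'X_i | j < d].

Definition monomial (d n : nat) := {m : 'X_{1..d < n.+1} | mdeg m == n}.
HB.instance Definition _ d n := Finite.on (monomial d n).

Definition expnt (d n : nat) (i : 'I_#|{: monomial d n}|) : 'X_{1..d} :=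
  val (val (enum_val i)).

(* For phi in the dual of S^n(V^* ): (g phi)(f) = phi(g^-1 f) = phi(f o g), so
   the coefficient (g phi)(x^a) of v^(a) in g phi is
   \sum_b (x^a o g)_b phi(x^b). *)
Definition divpow_mx (R : comNzRingType) (d n : nat) (A : 'M[R]_d) :
  'M[R]_#|{: monomial d n}| :=
  \matrix_(a, b) (mpoly_comp_mx A 'X_[expnt a])@_(expnt b).

Lemma expnt_inj d n : injective (@expnt d n).
Proof. by move=> i j /val_inj/val_inj/enum_val_inj. Qed.

Lemma expntP d n (m : 'X_{1..d}) : mdeg m = n ->
  exists i : 'I_#|{: monomial d n}|, expnt i = m.
Proof.
move=> mn; have mlt : (mdeg m < n.+1)%N by rewrite mn.
have mP : mdeg (BMultinom mlt) == n by rewrite /= mn.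
exists (enum_rank (exist _ (BMultinom mlt) mP : monomial d n)).
by rewrite /expnt enum_rankK.
Qed.

Lemma mdeg_expnt d n (i : 'I_#|{: monomial d n}|) : mdeg (expnt i) = n.
Proof. exact/eqP/(valP (enum_val i)). Qed.

Lemma dhomog_expntE (R : comNzRingType) d n (f : {mpoly R[d]}) :
  f \is n.-homog ->
  f = \sum_(i < #|{: monomial d n}|) f@_(expnt i) *: 'X_[expnt i].
Proof.
move=> hf; apply/mpolyP => m; rewrite raddf_sum /=.
have [mn|mn] := eqVneq (mdeg m) n.
  have [i im] := expntP mn; rewrite (bigD1 i) //= big1 => [|j ji].
    by rewrite mcoeffZ mcoeffX -im eqxx mulr1 addr0.
  by rewrite mcoeffZ mcoeffX -im (inj_eq (@expnt_inj d n)) (negPf ji) mulr0.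
rewrite (dhomog_nemf_coeff hf mn) big1 // => j _.
rewrite mcoeffZ mcoeffX; case: eqP => [E|]; last by rewrite mulr0.
by move: mn; rewrite -E mdeg_expnt eqxx.
Qed.

Lemma mpoly_comp_mxX (R : comNzRingType) d (A : 'M[R]_d) (m : 'X_{1..d}) :
  mpoly_comp_mx A 'X_[m] =
  \prod_(j < d) (\sum_(i < d) A j i *: 'X_i) ^+ m j.
Proof.
rewrite /mpoly_comp_mx comp_mpolyX; apply: eq_bigr => j _.
by rewrite tnth_mktuple.
Qed.

Lemma mpoly_comp_mx_homog (R : comNzRingType) d (A : 'M[R]_d) (m : 'X_{1..d}) :
  mpoly_comp_mx A 'X_[m] \is (mdeg m).-homog.
Proof.
rewrite mpoly_comp_mxX mdegE.
elim/big_ind2: _ => [|p1 d1 p2 d2 h1 h2|j _]; first exact: dhomog1.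
  exact: dhomogM.
rewrite -[X in X.-homog]mul1n; apply: dhomogMn.
by apply: rpred_sum => i _; apply: rpredZ; rewrite dhomogX /= mdeg1.
Qed.

Lemma mpoly_comp_mxM (R : comNzRingType) d (A B : 'M[R]_d) (m : 'X_{1..d}) :
  mpoly_comp_mx (A *m B) 'X_[m] = mpoly_comp_mx B (mpoly_comp_mx A 'X_[m]).
Proof.
rewrite !mpoly_comp_mxX /mpoly_comp_mx rmorph_prod /=; apply: eq_bigr => j _.
rewrite rmorphXn /=; congr (_ ^+ _); rewrite raddf_sum /=.
under [RHS]eq_bigr => i _ do
  rewrite comp_mpolyZ comp_mpolyXU -tnth_nth tnth_mktuple scaler_sumr.
rewrite exchange_big /=; apply: eq_bigr => l _; rewrite mxE scaler_suml.
by apply: eq_bigr => i _; rewrite scalerA.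
Qed.

Lemma divpow_mx1 (R : comNzRingType) d n :
  divpow_mx n (1%:M : 'M[R]_d) = 1%:M.
Proof.
apply/matrixP => a b; rewrite !mxE mpoly_comp_mxX.
rewrite (_ : \prod_j _ = 'X_[expnt a]).
  by rewrite mcoeffX (inj_eq (@expnt_inj d n)).
rewrite [RHS]mpolyXE_id; apply: eq_bigr => j _; congr (_ ^+ _).
rewrite (bigD1 j) //= big1 => [|i ij]; first by rewrite mxE eqxx scale1r addr0.
by rewrite mxE eq_sym (negPf ij) scale0r.
Qed.

Lemma divpow_mxM (R : comNzRingType) d n (A B : 'M[R]_d) :
  divpow_mx n (A *m B) = divpow_mx n A *m divpow_mx n B.
Proof.
apply/matrixP => a b; rewrite !mxE mpoly_comp_mxM.
have := mpoly_comp_mx_homog A (expnt a); rewrite mdeg_expnt => /dhomog_expntE.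
move=> {1}->; rewrite /mpoly_comp_mx [X in X@__](linear_sum (comp_mpoly _)).
rewrite (linear_sum (mcoeff _)) /=.
by apply: eq_bigr => c _; rewrite comp_mpolyZ mcoeffZ !mxE.
Qed.

Lemma divpow_mx_map (R S : comNzRingType) (f : {rmorphism R -> S}) d n
  (A : 'M[R]_d) : divpow_mx n (map_mx f A) = map_mx f (divpow_mx n A).
Proof.
apply/matrixP => a b; rewrite !mxE -mcoeff_map_mpoly !mpoly_comp_mxX.
congr (_@_ _); rewrite rmorph_prod /=; apply: eq_bigr => j _.
rewrite rmorphXn /=; congr (_ ^+ _); rewrite raddf_sum /=.
by apply: eq_bigr => i _; rewrite map_mpolyZ map_mpolyX mxE.
Qed.

Variables (V : gmodule k) (n : nat).

Definition divpow_act (R : comAlgType k) (g : 'M[R]_2) := divpow_mx n (gact V g).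

Fact divpow_act1 (R : comAlgType k) : divpow_act (1%:M : 'M[R]_2) = 1%:M.
Proof. by rewrite /divpow_act gact1 divpow_mx1. Qed.

Fact divpow_actM (R : comAlgType k) (g h : 'M[R]_2) : SL2 g -> SL2 h ->
  divpow_act (g *m h) = divpow_act g *m divpow_act h.
Proof. by move=> Hg Hh; rewrite /divpow_act gactM // divpow_mxM. Qed.

Fact divpow_act_natural (R S : comAlgType k) (f : {lrmorphism R -> S})
  (g : 'M[R]_2) : SL2 g -> divpow_act (map_mx f g) = map_mx f (divpow_act g).
Proof. by move=> Hg; rewrite /divpow_act gact_natural // divpow_mx_map. Qed.

Definition divpow : gmodule k :=
  GModule divpow_act1 divpow_actM divpow_act_natural.
End DividedPower.

(* The adjoint module sl_2(k), with basis e = E_01, h = E_00 - E_11, f = E_10. *)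
Section Adjoint.
Variable k : fieldType.

Definition sl2_basis (R : comNzRingType) (j : 'I_3) : 'M[R]_2 :=
  [:: delta_mx 0 1; delta_mx 0 0 - delta_mx 1 1; delta_mx 1 0]`_j.

(* the coordinates of a trace zero matrix in this basis *)
Definition sl2_coord (R : comNzRingType) (x : 'M[R]_2) (i : 'I_3) : R :=
  [:: x 0 1; x 0 0; x 1 0]`_i.

(* Ad g x = g x g^-1, where g^-1 = \adj g as \det g = 1 *)
Definition sl2_act (R : comAlgType k) (g : 'M[R]_2) : 'M[R]_3 :=
  \matrix_(i, j) sl2_coord (g *m sl2_basis R j *m \adj g) i.

Lemma sl2_coordK (R : comNzRingType) (x : 'M[R]_2) : \tr x = 0 ->
  x = \sum_i sl2_coord x i *: sl2_basis R i.
Proof.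
rewrite /mxtrace !big_ord_recl !big_ord0 !addr0 => /eqP.
rewrite addr_eq0 => /eqP x00.
rewrite /sl2_coord /sl2_basis /=.
apply/matrixP => i j; rewrite !mxE.
case: i => [[|[|]]] // i2; case: j => [[|[|]]] // j2;
  rewrite /= !(oppr0, mulr1, mulr0, addr0, add0r, subr0, sub0r, mulrN1).
- by congr (x _ _); apply: val_inj.
- by congr (x _ _); apply: val_inj.
- by congr (x _ _); apply: val_inj.
- by rewrite [x 0 0]x00 opprK; congr (x _ _); apply: val_inj.
Qed.

Lemma sl2_coord_sum (R : comNzRingType) (I : Type) (s : seq I) (c : I -> R)
    (x : I -> 'M[R]_2) i :
  sl2_coord (\sum_(j <- s) c j *: x j) i =
  \sum_(j <- s) c j * sl2_coord (x j) i.
Proof.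
case: i => [[|[|[|]]]] // i3; rewrite /sl2_coord /= summxE;
  by apply: eq_bigr => j _; rewrite mxE.
Qed.

Lemma mxtrace_sl2_basis (R : comNzRingType) j : \tr (sl2_basis R j) = 0.
Proof.
rewrite /mxtrace !big_ord_recl big_ord0 addr0.
by case: j => [[|[|[|]]]] // i3; rewrite /sl2_basis /= !mxE /=
  ?subr0 ?sub0r ?subrr ?addr0.
Qed.

Lemma mxtrace_conj (R : comNzRingType) (g x : 'M[R]_2) :
  SL2 g -> \tr (g *m x *m \adj g) = \tr x.
Proof. by move=> g1; rewrite mxtrace_mulC mulmxA mul_adj_mx g1 mul1mx. Qed.

Fact sl2_act1 (R : comAlgType k) : sl2_act (1%:M : 'M[R]_2) = 1%:M.
Proof.
apply/matrixP => i j; rewrite !mxE adj1 mulmx1 mul1mx.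
by case: i => [[|[|[|]]]] // i3; case: j => [[|[|[|]]]] // j3;
  rewrite /sl2_coord /sl2_basis /= !mxE /= ?subr0.
Qed.

Fact sl2_actM (R : comAlgType k) (g h : 'M[R]_2) : SL2 g -> SL2 h ->
  sl2_act (g *m h) = sl2_act g *m sl2_act h.
Proof.
move=> Hg Hh; apply/matrixP => i j; rewrite !mxE.
have adjM : \adj (g *m h) = \adj h *m \adj g.
  have /(congr1 (mulmx (\adj h *m \adj g))) := mul_mx_adj (g *m h).
  rewrite det_mulmx Hg Hh mulr1 mulmx1 mulmxA -(mulmxA _ _ (g *m h)).
  by rewrite (mulmxA _ g h) mul_adj_mx Hg mul1mx mul_adj_mx Hh mul1mx.
have -> : g *m h *m sl2_basis R j *m \adj (g *m h) =
    g *m (h *m sl2_basis R j *m \adj h) *m \adj g by rewrite adjM !mulmxA.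
rewrite [h *m _ *m \adj h]sl2_coordK; last first.
  by rewrite mxtrace_conj ?mxtrace_sl2_basis.
rewrite mulmx_sumr mulmx_suml.
under eq_bigr => l _ do rewrite -scalemxAr -scalemxAl.
by rewrite sl2_coord_sum; apply: eq_bigr => l _; rewrite !mxE mulrC.
Qed.

Fact sl2_act_natural (R S : comAlgType k) (f : {lrmorphism R -> S})
  (g : 'M[R]_2) : SL2 g -> sl2_act (map_mx f g) = map_mx f (sl2_act g).
Proof.
move=> _; apply/matrixP => i j; rewrite !mxE.
have -> : sl2_basis S j = map_mx f (sl2_basis R j).
  by case: j => [[|[|[|]]]] // i3; rewrite /sl2_basis /= ?map_mxB !map_delta_mx.
rewrite -map_mx_adj -!map_mxM.
by case: i => [[|[|[|]]]] // i3; rewrite /sl2_coord /= mxE.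
Qed.

Definition sl2 : gmodule k := GModule sl2_act1 sl2_actM sl2_act_natural.
End Adjoint.

(* D^m(sl_2), with D^m = 0 for m < 0 *)
Definition Dsl2 (k : fieldType) (m : int) : gmodule k :=
  match m with
  | Posz n => divpow (sl2 k) n
  | Negz _ => gtriv k 0
  end.

(* Main.v *)
Require Import Defs.
From mathcomp Require Import all_boot all_order all_algebra.
From mathcomp Require Import mpoly qpoly ring zify.

Set Implicit Arguments.
Unset Strict Implicit.
Unset Printing Implicit Defensive.
Import GRing.Theory.
Local Open Scope ring_scope.

(** The module D^n is the dual of S^n, where S = k[x0, x1, x2] is the ring of
functions on sl_2 in the basis e, h, f, so that G_1-invariants in D^n are linear
forms on the G_1-coinvariants of S^n.  Two facts describe them.

Sources of invariants.  S is a free module over S' = k[x0^p, x1^p, x2^p], and the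
coefficient of (x0 x1 x2)^(p-1) in the basis of monomials with exponents below p is
an S'-linear map tau : S -> S'.  Identify S' with S by x_i^p |-> x_i.  Then a linear
substitution A on the source of tau corresponds to the Frobenius of A on its target,
up to the factor det(A)^(p-1) ([trace_comp_mx], [top_char_det]); for A = Ad(g) the
determinant is 1.  The quadratic form
omega = x1^2 + x0 x2 (minus the determinant of the traceless matrix) is invariant.
Hence for each i the map s |-> tau(omega^i s) is equivariant from S^n to the
Frobenius twist of S^m, where n + 2 i = p m + 3 (p - 1), and its transpose
([trace_mx]) embeds the twist of D^m into D^n.  On the twist G_1 acts trivially, so
the image consists of invariants.  For given n exactly one i < p makes n + 2 i
congruent to 3 (p - 1) modulo p; the m it produces is q, q - 1 or q - 2, according
to the cases of the theorem.

Uniqueness.  A G_1-invariant linear form phi on S^n is killed by the Lie algebra,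
as one sees on the elements 1 + eps e and 1 + eps f over the dual numbers.  For the
values of phi on monomials this gives
2 a u(a-1, b+1, c) = b u(a, b-1, c+1) and 2 c u(a, b+1, c-1) = b u(a+1, b-1, c),
so that u(a, b, c) vanishes unless a = c in k, and the remaining values are linked
in chains (a, b, c), (a+1, b-2, c+1), and so on.  Along a chain everything is
determined by the values at monomials with b = -1 in k ([determined_by_section]),
except for the chain of x1^n, which is killed by going up to an exponent of x1
congruent to 1 modulo p when there is room to do so ([diagonal_zero]).  The monomials
with a = c and b = -1 are the p-th powers of monomials of degree m times
(x0 x2)^(p-1-i) x1^(p-1), and tau(omega^i _) maps them bijectively to the monomials of
degree m ([trace_section]).  Hence subtracting from phi an element of the image makes
it vanish on them, and therefore vanish.

When n <= p - 3 is even no such monomial exists and phi is determined by its value at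
x1^n; an equivariant phi with phi(x1^n) = n! is the power n/2 of the Laplacian
dual to omega ([trivial_iso]). *)

(** * The Frobenius trace of a polynomial ring *)

(** The exponent of (x_1 ... x_d)^(p-1), the largest monomial of the basis of the
polynomial ring over the subring generated by the x_i^p. *)
Definition topm (d p : nat) : 'X_{1..d} := [multinom p.-1 | _ < d].

Lemma mcoeffXM (R : comNzRingType) d (m n : 'X_{1..d}) (f : {mpoly R[d]}) :
  ('X_[m] * f)@_n = if (m <= n)%MM then f@_(n - m)%MM else 0.
Proof.
case: ifP => [mn|/negP mn].
  by rewrite mulrC -[in LHS](submK mn) addmC mcoeffMX.
apply/eqP; rewrite mcoeff_eq0 mulrC (perm_mem (msuppMX f m)).
apply/negP => /mapP[m' _ E]; apply: mn; rewrite E; exact: lem_addr.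
Qed.

Lemma pchar_mpoly (R : comNzRingType) d p :
  p \in [pchar R] -> p \in [pchar {mpoly R[d]}].
Proof. by move=> c; exact: rmorph_pchar (@mpolyC d R) _ c. Qed.

Lemma mpoly_Frobenius (R : comNzRingType) d p (charR : p \in [pchar R])
    (f : {mpoly R[d]}) :
  f ^+ p = \sum_(e <- msupp f) f@_e ^+ p *: 'X_[e *+ p].
Proof.
have cM := pchar_mpoly d charR.
rewrite {1}[f]mpolyE -(pFrobenius_autE cM) raddf_sum /=; apply: eq_bigr => e _.
by rewrite -mul_mpolyC rmorphM /= !pFrobenius_autE mpolyXn -mul_mpolyC -rmorphXn.
Qed.

Definition frob_mx (R : comNzRingType) p d (A : 'M[R]_d) : 'M[R]_d :=
  map_mx (fun x => x ^+ p) A.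

Lemma comp_mx_frob (R : comNzRingType) d p (charR : p \in [pchar R])
    (A : 'M[R]_d) (m e : 'X_{1..d}) :
  (mpoly_comp_mx (frob_mx p A) 'X_[m])@_e =
  (mpoly_comp_mx A 'X_[m])@_e ^+ p.
Proof.
rewrite -(pFrobenius_autE charR) -mcoeff_map_mpoly !mpoly_comp_mxX.
congr (_@_ _); rewrite rmorph_prod /=; apply: eq_bigr => j _.
rewrite rmorphXn /=; congr (_ ^+ _); rewrite raddf_sum /=.
by apply: eq_bigr => i _; rewrite map_mpolyZ map_mpolyX mxE.
Qed.

Lemma lem_mdeg_eq d (m1 m2 : 'X_{1..d}) :
  (m1 <= m2)%MM -> (mdeg m2 <= mdeg m1)%N -> m1 = m2.
Proof.
move=> le12 deg21; have E := submK le12.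
have : mdeg (m2 - m1)%MM = 0%N by move: (congr1 mdeg E); rewrite mdegD; lia.
by move/eqP; rewrite mdeg_eq0 => /eqP E0; rewrite -E E0 add0m.
Qed.

(** Multiplication by f^p moves exponents by multiples p e with e in the support of
f.  To reach p b + topm from an exponent in the support of g, one needs e <= b, and
the degree of f leaves only e = b.  This expresses the linearity of the trace over
p-th powers on the coefficients that matter. *)
Lemma mcoeff_Frobenius_mul (R : comNzRingType) d p (charR : p \in [pchar R])
    (f g : {mpoly R[d]}) (b : 'X_{1..d}) n : f \is n.-homog -> (mdeg b <= n)%N ->
  (f ^+ p * g)@_(b *+ p + topm d p)%MM = f@_b ^+ p * g@_(topm d p).
Proof.
move=> fh bn; have p_gt0 := prime_gt0 (pcharf_prime charR).
have term e : e \in msupp f -> e != b ->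
    ('X_[e *+ p] * g)@_(b *+ p + topm d p)%MM = 0.
  move=> ef eb; rewrite mcoeffXM; case: ifP => // /mnm_lepP le.
  case/eqP: eb; apply: lem_mdeg_eq; last first.
    by move/dhomogP: fh => /(_ _ ef) /= ->.
  apply/mnm_lepP => i; have := le i; rewrite mnmDE !mulmnE mnmE.
  move: (e i) (b i) => x y xy; rewrite leqNgt; apply/negP => yx.
  have : (y.+1 * p <= x * p)%N by rewrite leq_mul2r yx orbT.
  by rewrite mulSn; lia.
rewrite mpoly_Frobenius // mulr_suml raddf_sum /=.
under eq_big_seq => e ef do rewrite -scalerAl mcoeffZ.
have [bf|bf] := boolP (b \in msupp f).
  rewrite (bigD1_seq b) ?msupp_uniq //= big1_seq; last first.
    by move=> e /andP[eb ef]; rewrite term // mulr0.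
  by rewrite addr0 mcoeffXM lem_addr [(_ + topm d p)%MM]addmC addmK.
rewrite (memN_msupp_eq0 bf) expr0n eqn0Ngt p_gt0 mul0r big1_seq // => e /= ef.
by rewrite term ?mulr0 //; apply: contraNneq bf => <-.
Qed.

Lemma mnm_divn_eq d p (m : 'X_{1..d}) :
  m = ([multinom (m i %/ p)%N | i < d] *+ p + [multinom (m i %% p)%N | i < d])%MM.
Proof. by apply/mnmP => i; rewrite mnmDE mulmnE !mnmE -divn_eq. Qed.

Lemma mdeg_topm d p : mdeg (topm d p) = (d * p.-1)%N.
Proof.
by rewrite mdegE; under eq_bigr do rewrite mnmE; rewrite sum_nat_const card_ord.
Qed.

(** The action of A on the line spanned by (x_1 ... x_d)^(p-1) in the truncated
polynomial ring, where x_i^p = 0. *)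
Definition top_char (R : comNzRingType) p d (A : 'M[R]_d) : R :=
  (mpoly_comp_mx A 'X_[topm d p])@_(topm d p).

(** Write the monomial as x^(p q + r) with all exponents of r below p.  The factor
x^(p q) is a p-th power, which contributes the Frobenius of A; the factor x^r
contributes only if r is the top exponent, because otherwise its degree is too small
to reach the top one. *)
Lemma trace_comp_mxX (R : comNzRingType) d p (charR : p \in [pchar R])
    (A : 'M[R]_d) n (e b : 'X_{1..d}) :
  mdeg e = (n * p + d * p.-1)%N -> mdeg b = n ->
  (mpoly_comp_mx A 'X_[e])@_(b *+ p + topm d p)%MM =
  top_char p A * \sum_(c < #|{: monomial d n}|)
    'X_[e]@_(expnt c *+ p + topm d p)%MM *
    (mpoly_comp_mx (frob_mx p A) 'X_[expnt c])@_b.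
Proof.
move=> dege degb; have p_gt0 := prime_gt0 (pcharf_prime charR).
set q : 'X_{1..d} := [multinom (e i %/ p)%N | i < d].
set r : 'X_{1..d} := [multinom (e i %% p)%N | i < d].
have def_e : e = (q *+ p + r)%MM by exact: mnm_divn_eq.
have r_le : (r <= topm d p)%MM.
  by apply/mnm_lepP => i; rewrite !mnmE -ltnS prednK ?ltn_mod.
have deg_r : (mdeg r <= d * p.-1)%N.
  by rewrite -mdeg_topm -[X in (_ <= mdeg X)%N](submK r_le) mdegD leq_addl.
have deg_qr : (mdeg q * p + mdeg r = n * p + d * p.-1)%N.
  by rewrite -dege def_e mdegD mdegMn.
have n_le : (n <= mdeg q)%N.
  by rewrite -(leq_pmul2r p_gt0); lia.
have -> : mpoly_comp_mx A 'X_[e] =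
    mpoly_comp_mx A 'X_[q] ^+ p * mpoly_comp_mx A 'X_[r].
  by rewrite {1}def_e mpolyXD -mpolyXn /mpoly_comp_mx rmorphM rmorphXn.
rewrite (mcoeff_Frobenius_mul charR _ (mpoly_comp_mx_homog A q)) ?degb //.
have [r_top|r_ntop] := eqVneq r (topm d p); last first.
  rewrite (dhomog_nemf_coeff (mpoly_comp_mx_homog A r)) ?mulr0; last first.
    by apply: contraNneq r_ntop => /= E; rewrite (lem_mdeg_eq r_le) ?E.
  rewrite big1 ?mulr0 // => c _; rewrite mcoeffX.
  case: eqP => [E|]; last by rewrite mul0r.
  case/eqP: r_ntop; apply/mnmP => i; rewrite [LHS]mnmE E mnmDE mulmnE !mnmE.
  by rewrite modnMDl modn_small // ltn_predL.
have deg_q : mdeg q = n.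
  move: deg_qr; rewrite r_top mdeg_topm => /addIn /eqP.
  by rewrite eqn_pmul2r // => /eqP.
have [c0 c0E] := expntP deg_q.
rewrite (bigD1 c0) //= big1 ?addr0 => [|c cc0]; last first.
  rewrite mcoeffX def_e r_top eqm_add2r.
  case: eqP => [/mnmP E|]; last by rewrite mul0r.
  case/eqP: cc0; apply/expnt_inj/mnmP => i; have := E i.
  by rewrite !mulmnE -c0E => /eqP; rewrite eqn_pmul2r // => /eqP ->.
rewrite c0E (comp_mx_frob charR) mcoeffX def_e r_top.
by rewrite eqxx mul1r mulrC.
Qed.

(** The equivariance of the trace: the coefficients of the x^(p b + topm), viewed as
a polynomial in the x^b, transform by the Frobenius of A up to the factor top_char. *)
Lemma trace_comp_mx (R : comNzRingType) d p (charR : p \in [pchar R])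
    (A : 'M[R]_d) n (s : {mpoly R[d]}) (b : 'X_{1..d}) :
  s \is (n * p + d * p.-1).-homog -> mdeg b = n ->
  (mpoly_comp_mx A s)@_(b *+ p + topm d p)%MM =
  top_char p A * \sum_(c < #|{: monomial d n}|)
    s@_(expnt c *+ p + topm d p)%MM *
    (mpoly_comp_mx (frob_mx p A) 'X_[expnt c])@_b.
Proof.
move=> /dhomogP hs degb; rewrite {1}[s]mpolyE /mpoly_comp_mx.
rewrite [X in X@__](linear_sum (comp_mpoly _)) (linear_sum (mcoeff _)) /=.
have -> : \sum_(c < #|{: monomial d n}|)
    s@_(expnt c *+ p + topm d p)%MM *
    (mpoly_comp_mx (frob_mx p A) 'X_[expnt c])@_b =
  \sum_(e <- msupp s) s@_e * \sum_(c < #|{: monomial d n}|)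
    'X_[e]@_(expnt c *+ p + topm d p)%MM *
    (mpoly_comp_mx (frob_mx p A) 'X_[expnt c])@_b.
  under [RHS]eq_bigr => e _ do rewrite mulr_sumr.
  rewrite exchange_big /=; apply: eq_bigr => c _.
  rewrite {1}[s]mpolyE (linear_sum (mcoeff _)) mulr_suml; apply: eq_bigr => e _.
  by rewrite /= mcoeffZ mulrA.
rewrite mulr_sumr; apply: eq_big_seq => e es.
rewrite comp_mpolyZ mcoeffZ -/(mpoly_comp_mx A 'X_[e]).
by rewrite (trace_comp_mxX charR A (hs e es) degb) mulrCA.
Qed.

(** The p-th power of a linear form is zero in the truncated polynomial ring. *)
Lemma mcoeff_top_powp (R : comNzRingType) d p (charR : p \in [pchar R])
    (l f : {mpoly R[d]}) : l \is 1.-homog -> (l ^+ p * f)@_(topm d p) = 0.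
Proof.
move=> lh; have := mcoeff_Frobenius_mul charR f (b := 0%MM) lh.
rewrite mdeg0 => /(_ isT) E.
have -> : topm d p = (0%MM *+ p + topm d p)%MM.
  by apply/mnmP => i; rewrite mnmDE mulmnE mnm0E mul0n.
have l0 : l@_0%MM = 0 by apply: (dhomog_nemf_coeff lh); rewrite /= mdeg0.
rewrite E l0 expr0n eqn0Ngt.
by rewrite (prime_gt0 (pcharf_prime charR)) mul0r.
Qed.

(** Elementary row operations on a matrix do not change the product of the (p-1)-st
powers of its rows, seen as linear forms, modulo p-th powers: the difference is a
multiple of l^p. *)
Lemma mcoeff_top_row_op (R : comNzRingType) d p (charR : p \in [pchar R])
    (l u f g : {mpoly R[d]}) : l \is 1.-homog ->
  (f * (u + g * l) ^+ p.-1 * l ^+ p.-1)@_(topm d p) =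
  (f * u ^+ p.-1 * l ^+ p.-1)@_(topm d p).
Proof.
move=> lh; apply/eqP; rewrite -subr_eq0 -mcoeffB -mulrBl -mulrBr subrXX.
rewrite [u + _]addrC addrK; set t := \sum_(i < _) _.
have -> : f * (g * l * t) * l ^+ p.-1 = l ^+ p * (f * g * t).
  by rewrite -[in RHS](prednK (prime_gt0 (pcharf_prime charR))) exprS; ring.
by rewrite mcoeff_top_powp.
Qed.

Lemma big3 (V : nmodType) (F : 'I_3 -> V) : \sum_(i < 3) F i = F 0 + F 1 + F 2.
Proof.
rewrite !big_ord_recl big_ord0 addr0 addrA; congr (_ + F _ + F _); exact: val_inj.
Qed.

Lemma prod3 (S : comNzRingType) (F : 'I_3 -> S) : \prod_(i < 3) F i = F 0 * F 1 * F 2.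
Proof.
rewrite !big_ord_recl big_ord0 mulr1 mulrA; congr (_ * F _ * F _); exact: val_inj.
Qed.

Lemma det_mx33 (R : comNzRingType) (A : 'M[R]_3) :
  \det A = A 0 0 * (A 1 1 * A 2 2 - A 1 2 * A 2 1)
         - A 0 1 * (A 1 0 * A 2 2 - A 1 2 * A 2 0)
         + A 0 2 * (A 1 0 * A 2 1 - A 1 1 * A 2 0).
Proof.
pose B i j := A (inord i) (inord j).
have AB i j : A i j = B (val i) (val j) by rewrite /B !inord_val.
rewrite (expand_det_row _ 0) !big_ord_recl big_ord0 /cofactor.
rewrite !(expand_det_row _ ord0) !big_ord_recl !big_ord0 /cofactor !det_mx11 !mxE.
rewrite !AB /= /bump /=; ring.
Qed.

(** Fraction-free Gaussian elimination on the three rows l_0, l_1, l_2 of A, with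
pivots a and M 1 1.  Each step multiplies a row by its pivot, which the factors
a^(p-1) and M_11^(p-1) pay for, so the argument works over any ring. *)
Section TopChar3.
Variables (R : comNzRingType) (p : nat).
Hypothesis charR : p \in [pchar R].
Variable A : 'M[R]_3.

Let l (i : 'I_3) : {mpoly R[3]} := \sum_(j < 3) A i j *: 'X_j.
Let a := A 0 0.
Let M (i j : 'I_3) := a * A i j - A i 0 * A 0 j.
Let C (x : R) : {mpoly R[3]} := x%:MP.
Let X (i : 'I_3) : {mpoly R[3]} := 'X_i.

Let lE i : l i = C (A i 0) * X 0 + C (A i 1) * X 1 + C (A i 2) * X 2.
Proof. by rewrite /l big3 /C !mul_mpolyC. Qed.

Let lh i : l i \is 1.-homog.
Proof.
by apply: rpred_sum => j _; apply: rpredZ; rewrite dhomogX /= mdeg1.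
Qed.

Let Xh i : X i \is 1.-homog.
Proof. by rewrite dhomogX /= mdeg1. Qed.

Let W (f : {mpoly R[3]}) := f@_(topm 3 p).

Let WC c (f : {mpoly R[3]}) : W (C c * f) = c * W f.
Proof. by rewrite /W mcoeffCM. Qed.

(** The rows after the elimination of x0 from l_1 and l_2. *)
Let m i := C (M i 1) * X 1 + C (M i 2) * X 2.

Let mh i : m i \is 1.-homog.
Proof. by rewrite /m /C !mul_mpolyC; apply: rpredD; apply: rpredZ; exact: Xh. Qed.

Let m_l i : C a * l i = m i + C (A i 0) * l 0.
Proof. by rewrite /m !lE /M /C !mpolyCB !mpolyCM -/a /a; ring. Qed.

Let D := M 1 1 * M 2 2 - M 1 2 * M 2 1.

Let m_m : C (M 1 1) * m 2 = C D * X 2 + C (M 2 1) * m 1.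
Proof.
rewrite /m /D; move: (M 1 1) (M 1 2) (M 2 1) (M 2 2) => x y z t.
by rewrite /C mpolyCB !mpolyCM; ring.
Qed.

Let DE : D = a * \det A.
Proof. by rewrite det_mx33 /D /M /a; ring. Qed.

Let N := p.-1.

Let WZ c (f u g : {mpoly R[3]}) :
  c ^+ N * W (f * u ^+ N * g) = W (f * (C c * u) ^+ N * g).
Proof. by rewrite -WC /C rmorphXn exprMn; congr W; ring. Qed.

Let row_op (h u f g : {mpoly R[3]}) : h \is 1.-homog ->
  W (f * (u + g * h) ^+ N * h ^+ N) = W (f * u ^+ N * h ^+ N).
Proof. exact: mcoeff_top_row_op. Qed.

Lemma top_char_elim : top_char p A * (a ^+ N * a ^+ N * M 1 1 ^+ N) =
  (\det A) ^+ N * (a ^+ N * a ^+ N * M 1 1 ^+ N).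
Proof.
have -> : top_char p A = W (l 2 ^+ N * l 1 ^+ N * l 0 ^+ N).
  rewrite /top_char mpoly_comp_mxX prod3 !mnmE /W; congr (_@__).
  by rewrite -mulrA [RHS]mulrC [l 2 ^+ N * _]mulrC.
have step1 : a ^+ N * W (l 2 ^+ N * l 1 ^+ N * l 0 ^+ N) =
    W (m 1 ^+ N * l 2 ^+ N * l 0 ^+ N).
  by rewrite WZ m_l (row_op (m 1) _ _ (lh 0)) [l 2 ^+ N * _]mulrC.
have step2 : a ^+ N * W (m 1 ^+ N * l 2 ^+ N * l 0 ^+ N) =
    W (l 0 ^+ N * m 2 ^+ N * m 1 ^+ N).
  by rewrite WZ m_l (row_op (m 2) _ _ (lh 0)) mulrC mulrA mulrAC.
have step3 : M 1 1 ^+ N * W (l 0 ^+ N * m 2 ^+ N * m 1 ^+ N) =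
    D ^+ N * W (l 0 ^+ N * m 1 ^+ N * X 2 ^+ N).
  by rewrite WZ m_m (row_op (C D * X 2) _ _ (mh 1)) -WZ mulrAC.
have step4 : W (l 0 ^+ N * m 1 ^+ N * X 2 ^+ N) =
    M 1 1 ^+ N * W (X 2 ^+ N * l 0 ^+ N * X 1 ^+ N).
  rewrite {1}/m (row_op (C (M 1 1) * X 1) _ _ (Xh 2)) -WZ; congr (_ * W _).
  by rewrite mulrC mulrA.
have step5 : W (X 2 ^+ N * l 0 ^+ N * X 1 ^+ N) = a ^+ N.
  have -> : l 0 = C a * X 0 + C (A 0 2) * X 2 + C (A 0 1) * X 1.
    by rewrite lE addrAC.
  rewrite (row_op _ _ _ (Xh 1)) mulrC [X 2 ^+ N * _]mulrC mulrA.
  rewrite (row_op (C a * X 0) _ _ (Xh 2)) -WZ.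
  rewrite [X in W X](_ : _ = 'X_[topm 3 p]).
    by rewrite /W mcoeffX eqxx mulr1.
  by rewrite mpolyXE_id prod3 !mnmE [X 1 ^+ N * _]mulrC.
transitivity (M 1 1 ^+ N * (a ^+ N * (a ^+ N *
    W (l 2 ^+ N * l 1 ^+ N * l 0 ^+ N)))); first by ring.
by rewrite step1 step2 step3 step4 step5 DE exprMn; ring.
Qed.
End TopChar3.

(** The pivots need not be cancellable in R, but those of A + t I are monic
polynomials in t.  The identity holds for A + t I and is specialized at t = 0. *)
Lemma top_char_det (R : comNzRingType) p (charR : p \in [pchar R]) (A : 'M[R]_3) :
  top_char p A = \det A ^+ p.-1.
Proof.
pose B : 'M[{poly R}]_3 := map_mx polyC A + ('X)%:M.
have charP : p \in [pchar {poly R}] by exact: rmorph_pchar polyC _ charR.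
have B00 : B 0 0 = 'X + (A 0 0)%:P by rewrite !mxE addrC.
have M11 : B 0 0 * B 1 1 - B 1 0 * B 0 1 \is monic.
  rewrite !mxE /= !mulr1n !mulr0n !addr0 -polyCM.
  have -> : ((A 0 0)%:P + 'X) * ((A 1 1)%:P + 'X) - (A 1 0 * A 0 1)%:P =
     'X^2 + ((A 0 0 + A 1 1)%:P * 'X + (A 0 0 * A 1 1 - A 1 0 * A 0 1)%:P).
    by rewrite polyCB polyCD !polyCM; ring.
  rewrite monicE lead_coefDl ?lead_coefXn // size_polyXn.
  rewrite (leq_ltn_trans (size_polyD _ _)) // gtn_max.
  rewrite (leq_ltn_trans (size_polyC_leq1 _)) // andbT.
  by rewrite mul_polyC (leq_ltn_trans (size_scale_leq _ _)) // size_polyX.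
have chi_B : top_char p B = \det B ^+ p.-1.
  have reg_a : GRing.lreg (B 0 0) by apply: monic_lreg; rewrite B00 monicXaddC.
  pose z := B 0 0 ^+ p.-1 * B 0 0 ^+ p.-1 * (B 0 0 * B 1 1 - B 1 0 * B 0 1) ^+ p.-1.
  have reg_z : GRing.lreg z.
    by do 2?apply: lregM; apply: lregX => //; exact: monic_lreg.
  by apply: reg_z; rewrite ![z * _]mulrC; exact: top_char_elim.
have horner0 : map_mx (horner_eval 0) B = A.
  apply/matrixP => i j; rewrite !mxE /horner_eval hornerD hornerC.
  by rewrite hornerMn hornerX mul0rn addr0.
have := congr1 (horner_eval 0) chi_B.
rewrite rmorphXn -det_map_mx horner0 => <-.
have := divpow_mx_map (horner_eval (0 : R)) (3 * p.-1) B.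
rewrite horner0 => /matrixP E.
have [c cE] := expntP (mdeg_topm 3 p).
by have := E c c; rewrite !mxE cE.
Qed.

(** * The adjoint action and its invariant quadratic form *)

Lemma det_mx22E (R : comNzRingType) (g : 'M[R]_2) :
  \det g = g 0 0 * g 1 1 - g 0 1 * g 1 0.
Proof.
pose B i j := g (inord i) (inord j).
have gB i j : g i j = B (val i) (val j) by rewrite /B !inord_val.
rewrite (expand_det_row _ 0) !big_ord_recl big_ord0 /cofactor !det_mx11 !mxE.
by rewrite !gB /= /bump /=; ring.
Qed.

Lemma adj_mx22E (R : comNzRingType) (g : 'M[R]_2) i j :
  \adj g i j = if i == j then g (1 - i) (1 - j) else - g i j.
Proof.
pose B i j := g (inord i) (inord j).
have gB i' j' : g i' j' = B (val i') (val j') by rewrite /B !inord_val.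
case: i => [[|[|]]] // i2; case: j => [[|[|]]] // j2;
  by rewrite !mxE /cofactor det_mx11 !mxE !gB /= /bump /= ; ring.
Qed.

Definition ad_mx (R : comNzRingType) (a b c d : R) : 'M[R]_3 :=
  \matrix_(i, j)
    nth 0 (nth [::] [:: [:: a ^+ 2; - (2 * a * b); - b ^+ 2];
                        [:: - (a * c); a * d + b * c; b * d];
                        [:: - c ^+ 2; 2 * c * d; d ^+ 2]] i) j.

Lemma sl2_actE (k : fieldType) (R : comAlgType k) (g : 'M[R]_2) :
  sl2_act g = ad_mx (g 0 0) (g 0 1) (g 1 0) (g 1 1).
Proof.
apply/matrixP => i j.
pose B i j := g (inord i) (inord j).
have gB i' j' : g i' j' = B (val i') (val j') by rewrite /B !inord_val.
case: i => [[|[|[|]]]] // i3; case: j => [[|[|[|]]]] // j3;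
rewrite !mxE /sl2_coord /sl2_basis /= !mxE !big_ord_recl !big_ord0 !adj_mx22E;
rewrite ?mxE /= !big_ord_recl !big_ord0 !mxE /= !gB /=.
all: ring.
Qed.

Lemma det_ad_mx (R : comNzRingType) (a b c d : R) :
  \det (ad_mx a b c d) = (a * d - b * c) ^+ 3.
Proof. by rewrite det_mx33 !mxE /=; ring. Qed.

(** Minus the determinant of the traceless matrix with coordinates x0, x1, x2. *)
Definition omega (R : comNzRingType) : {mpoly R[3]} := 'X_1 ^+ 2 + 'X_0 * 'X_2.

Lemma mpoly_comp_mxXU (R : comNzRingType) d (A : 'M[R]_d) i :
  mpoly_comp_mx A 'X_i = \sum_(j < d) A i j *: 'X_j.
Proof. by rewrite /mpoly_comp_mx comp_mpolyXU -tnth_nth tnth_mktuple. Qed.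

Lemma omega_ad_mx (R : comNzRingType) (a b c d : R) :
  mpoly_comp_mx (ad_mx a b c d) (omega R) = ((a * d - b * c) ^+ 2)%:MP * omega R.
Proof.
rewrite /omega {1}/mpoly_comp_mx rmorphD rmorphM rmorphXn /=.
rewrite -!/(mpoly_comp_mx _ _) !mpoly_comp_mxXU !big3 !mxE /= -!mul_mpolyC.
rewrite !(rmorphN, rmorphB, rmorphD, rmorphM, rmorphXn, rmorph_nat) /=.
ring.
Qed.

Lemma omega_homog (R : comNzRingType) : omega R \is 2.-homog.
Proof.
apply: rpredD; first by rewrite mpolyXn dhomogX /= mdegMn mdeg1.
by rewrite -mpolyXD dhomogX /= mdegD !mdeg1.
Qed.

Lemma map_omega (R S : comNzRingType) (f : {rmorphism R -> S}) :
  map_mpoly f (omega R) = omega S.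
Proof. by rewrite /omega rmorphD rmorphM rmorphXn /= !map_mpolyX. Qed.

Lemma map_ad_mx (R S : comNzRingType) (f : {rmorphism R -> S}) (a b c d : R) :
  map_mx f (ad_mx a b c d) = ad_mx (f a) (f b) (f c) (f d).
Proof.
apply/matrixP => i j.
case: i => [[|[|[|]]]] // i3; case: j => [[|[|[|]]]] // j3;
by rewrite !mxE /= ?(rmorphN, rmorphD, rmorphM, rmorphXn, rmorph1).
Qed.

Lemma SL2_entries (k : fieldType) (R : comAlgType k) (g : 'M[R]_2) :
  SL2 g -> g 0 0 * g 1 1 - g 0 1 * g 1 0 = 1.
Proof. by rewrite -det_mx22E. Qed.

Lemma sl2_act_frob (k : fieldType) (R : comAlgType k) p (charR : p \in [pchar R])
  (g : 'M[R]_2) : sl2_act (frob p g) = frob_mx p (sl2_act g).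
Proof.
by rewrite !sl2_actE !mxE; symmetry; exact: (map_ad_mx (pFrobenius_aut charR)).
Qed.

(** The transpose of s |-> tau(omega^i s), where tau extracts the coefficients of the
x^(p b + topm) as those of x^b. *)
Definition trace_mx (k : fieldType) (p i n m : nat) :
  'M[k]_(#|{: monomial 3 n}|, #|{: monomial 3 m}|) :=
  \matrix_(a, b) (omega k ^+ i * 'X_[expnt a])@_(expnt b *+ p + topm 3 p)%MM.

Lemma base_change_trace_mx (k : fieldType) (R : comAlgType k) p i n m a b :
  base_change R (trace_mx k p i n m) a b =
  (omega R ^+ i * 'X_[expnt a])@_(expnt b *+ p + topm 3 p)%MM.
Proof.
rewrite !mxE -mcoeff_map_mpoly rmorphM rmorphXn /= map_omega.
by rewrite map_mpolyX.
Qed.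

(** As g fixes omega^i and det(Ad g) = 1, this is the equivariance of tau applied to
omega^i s. *)
Lemma trace_mx_equivariant (k : fieldType) p (charp : p \in [pchar k]) i n m :
  (i * 2 + n = m * p + 3 * p.-1)%N ->
  @equivariant k (gtwist (Dsl2 k m%:Z) charp) (Dsl2 k n%:Z) (trace_mx k p i n m).
Proof.
move=> deg_eq R g det_g; have charR := rmorph_pchar (GRing.in_alg R) charp.
apply/matrixP => a b; rewrite [LHS]mxE [RHS]mxE /=.
rewrite /twist_act /= /divpow_act /= sl2_act_frob //.
set G := sl2_act g.
have detG : \det G = 1.
  by rewrite /G sl2_actE det_ad_mx SL2_entries // expr1n.
have omegaG : mpoly_comp_mx G (omega R) = omega R.
  by rewrite /G sl2_actE omega_ad_mx SL2_entries // expr1n mpolyC1 mul1r.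
have hom : omega R ^+ i * 'X_[expnt a] \is (m * p + 3 * p.-1).-homog.
  rewrite -deg_eq mulnC; apply: dhomogM; first exact/dhomogMn/omega_homog.
  by rewrite dhomogX /= mdeg_expnt.
have := trace_comp_mx charR G hom (mdeg_expnt b).
rewrite top_char_det // detG expr1n mul1r => E.
transitivity (mpoly_comp_mx G (omega R ^+ i * 'X_[expnt a]))@_
    (expnt b *+ p + topm 3 p)%MM.
  rewrite E; apply: eq_bigr => c _.
  by rewrite base_change_trace_mx [X in _ * X]mxE.
rewrite /mpoly_comp_mx rmorphM rmorphXn /= -!/(mpoly_comp_mx _ _) omegaG.
have := mpoly_comp_mx_homog G (expnt a); rewrite mdeg_expnt => /dhomog_expntE.
move=> {1}->; rewrite mulr_sumr raddf_sum /=.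
apply: eq_bigr => c _; rewrite base_change_trace_mx -scalerAr mcoeffZ.
by rewrite mxE.
Qed.

(** * A section of the trace *)

Definition mnm3 (a b c : nat) : 'X_{1..3} := [multinom nth 0%N [:: a; b; c] i | i < 3].

Lemma mnm3P (m : 'X_{1..3}) : m = mnm3 (m 0) (m 1) (m 2).
Proof.
apply/mnmP => -[[|[|[|]]] i3] //; rewrite mnmE /=;
by congr (m _); apply: val_inj.
Qed.

Lemma mnm3_eq a b c a' b' c' :
  (mnm3 a b c == mnm3 a' b' c') = [&& a == a', b == b' & c == c'].
Proof.
apply/eqP/and3P => [/mnmP E|[/eqP-> /eqP-> /eqP->] //].
by split; apply/eqP; [have := E 0|have := E 1|have := E 2]; rewrite !mnmE.
Qed.

Lemma mdeg_mnm3 a b c : mdeg (mnm3 a b c) = (a + b + c)%N.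
Proof. by rewrite mdegE !big_ord_recl big_ord0 !mnmE /= addn0 addnA. Qed.

Lemma mnm3D a b c a' b' c' :
  (mnm3 a b c + mnm3 a' b' c')%MM = mnm3 (a + a') (b + b') (c + c').
Proof. by apply/mnmP => -[[|[|[|]]] i3] //; rewrite !mnmE. Qed.

Lemma mnm3M a b c p : (mnm3 a b c *+ p)%MM = mnm3 (a * p) (b * p) (c * p).
Proof. by apply/mnmP => -[[|[|[|]]] i3] //; rewrite !mulmnE !mnmE. Qed.

Lemma topm3 p : topm 3 p = mnm3 p.-1 p.-1 p.-1.
Proof. by apply/mnmP => -[[|[|[|]]] i3] //; rewrite !mnmE. Qed.

Lemma mpolyX3 (R : comNzRingType) a b c :
  'X_[mnm3 a b c] = 'X_0 ^+ a * 'X_1 ^+ b * 'X_2 ^+ c :> {mpoly R[3]}.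
Proof. by rewrite mpolyXE_id prod3 !mnmE. Qed.

Lemma omegaXn (R : comNzRingType) i :
  omega R ^+ i = \sum_(j < i.+1) 'X_[mnm3 j (2 * (i - j)) j] *+ 'C(i, j).
Proof.
rewrite /omega exprDn; apply: eq_bigr => j _; congr (_ *+ _).
by rewrite mpolyX3 exprM [('X_0 * 'X_2) ^+ j]exprMn mulrCA mulrA.
Qed.

(** The product of a p-th power x^(p b) with the cofactor of (x0 x2)^i in
(x0 x1 x2)^(p-1), chosen because (x0 x2)^i is a term of omega^i with coefficient 1. *)
Definition section_mnm p i (b : 'X_{1..3}) : 'X_{1..3} :=
  (b *+ p + mnm3 (p.-1 - i) p.-1 (p.-1 - i))%MM.

(** In omega^i the terms other than (x0 x2)^i have an exponent j < i at x0, and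
p - 1 - i + j is not congruent to p - 1 modulo p. *)
Lemma trace_section (R : comNzRingType) p i b b' : (i < p)%N ->
  (omega R ^+ i * 'X_[section_mnm p i b])@_(b' *+ p + topm 3 p)%MM = (b == b')%:R.
Proof.
move=> ip; rewrite omegaXn mulr_suml raddf_sum /=.
rewrite [b]mnm3P [b']mnm3P /section_mnm !mnm3M topm3 !mnm3D mnm3_eq.
move: (b 0) (b 1) (b 2) (b' 0) (b' 1) (b' 2) => x y z x' y' z'.
have p0 : (0 < p)%N by lia.
rewrite big_ord_recr /= binn mulr1n -mpolyXD mcoeffX subnn muln0 mnm3D mnm3_eq.
rewrite big1 ?add0r => [|j _].
  congr (_%:R).
  have E u v : (u == v) = (u * p == v * p)%N by rewrite eqn_pmul2r.
  rewrite (E x x') (E y y') (E z z').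
  by congr (nat_of_bool [&& _, _ & _]); apply/eqP/eqP; lia.
rewrite mulrnAl mcoeffMn -mpolyXD mcoeffX mnm3D mnm3_eq.
case: eqP => [E|]; last by rewrite mul0rn.
have ji := ltn_ord j; exfalso.
have [le|le] := leqP x x'.
  by have [d Ed] : exists d, x' = (x + d)%N; [exists (x' - x)%N; lia|];
   case: d Ed => [|d] -> in E *; nia.
have : (x'.+1 * p <= x * p)%N by rewrite leq_mul2r le orbT.
by rewrite mulSn; lia.
Qed.

(** * Linear forms killed by the Lie algebra *)

(** The function u gives the values of a linear form on the monomials of degree n,
and the two hypotheses say that the form kills the images of the derivations
e and f of sl_2. *)
Section Coinvariants.
Variables (k : fieldType) (n : nat) (u : nat -> nat -> nat -> k).
Hypothesis two_neq0 : 2 != 0 :> k.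
Hypothesis uE : forall a b c, (a + b + c = n)%N ->
  2 * a%:R * u a.-1 b.+1 c = b%:R * u a b.-1 c.+1.
Hypothesis uF : forall a b c, (a + b + c = n)%N ->
  2 * c%:R * u a b.+1 c.-1 = b%:R * u a.+1 b.-1 c.

Let cancel (x y : k) : x != 0 -> x * y = 0 -> y = 0.
Proof. by move=> x0 /eqP; rewrite mulf_eq0 (negPf x0) => /eqP. Qed.

(** The action of h is the commutator of those of e and f, and the monomial has
weight 2 (a - c) up to sign. *)
Lemma weight_zero a b c : (a + b + c = n)%N -> a%:R != c%:R :> k -> u a b c = 0.
Proof.
have pos_b a' b' c' : (a' + b'.+1 + c' = n)%N -> a'%:R != c'%:R :> k -> u a' b'.+1 c' = 0.
  move=> abc ac; apply: (@cancel (2 * (a'%:R - c'%:R))).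
    by rewrite mulf_neq0 // subr_eq0.
  have e1 := uE (a := a'.+1) (b := b') (c := c') ltac:(lia).
  have e2 := uF (a := a') (b := b') (c := c'.+1) ltac:(lia).
  rewrite /= -[a'.+1%:R]natr1 in e1; rewrite /= -[c'.+1%:R]natr1 in e2.
  have : 2 * (a'%:R + 1) * u a' b'.+1 c' = 2 * (c'%:R + 1) * u a' b'.+1 c'.
    by rewrite e1 e2.
  by move/eqP; rewrite -subr_eq0 => /eqP <-; ring.
case: b => [|b]; last exact: pos_b.
rewrite addn0; case: a => [|a]; case: c => [|c] abc ac.
- by rewrite eqxx in ac.
- have := uE (a := 0%N) (b := 1%N) (c := c) ltac:(lia).
  by rewrite /= mulr0 mul0r mul1r.
- have := uF (a := a) (b := 1%N) (c := 0%N) ltac:(lia).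
  by rewrite /= mulr0 mul0r mul1r.
have := uE (a := a.+1) (b := 1%N) (c := c) ltac:(lia).
rewrite /= mul1r => <-; rewrite pos_b ?mulr0 //; first by lia.
by move: ac; rewrite -!natr1 (inj_eq (addIr _)).
Qed.

(** Induction on a.  If c > 0, the relation for e expresses (b+1) u(a, b, c) by
u(a-1, b+2, c-1); if c = 0 < a, then a = c = 0 in k and the relation for f reads
(b+1) u(a, b, c) = 0.  Here b + 1 is invertible unless b = -1 in k, and only
(0, n, 0) is out of reach of both relations. *)
Lemma determined_by_section :
  (forall a b c, (a + b + c = n)%N -> b%:R = -1 :> k -> a%:R = c%:R :> k ->
     u a b c = 0) ->
  u 0 n 0 = 0 ->
  forall a b c, (a + b + c = n)%N -> u a b c = 0.
Proof.
move=> u_sec u_n a; elim: a => [|a IH] b c abc.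
  have [c0|c_gt0] := posnP c; first by move: abc; rewrite c0 addn0 add0n => ->.
  have [ac|] := eqVneq (0%N%:R : k) c%:R; last exact: weight_zero.
  have [b1|b1] := eqVneq b%:R (-1 : k); first exact: u_sec.
  apply: (@cancel (b.+1)%:R); first by rewrite -natr1 addr_eq0 b1.
  have := uE (a := 0%N) (b := b.+1) (c := c.-1) ltac:(lia).
  by rewrite mulr0 mul0r prednK.
have [ac|] := eqVneq (a.+1%:R : k) c%:R; last exact: weight_zero.
have [b1|b1] := eqVneq b%:R (-1 : k); first exact: u_sec.
apply: (@cancel (b.+1)%:R); first by rewrite -natr1 addr_eq0 b1.
have [c0|c_gt0] := posnP c.
  have := uF (a := a) (b := b.+1) (c := 0%N) ltac:(lia).
  by rewrite mulr0 mul0r c0.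
have := uE (a := a.+1) (b := b.+1) (c := c.-1) ltac:(lia).
by rewrite IH /= ?prednK ?mulr0 //; lia.
Qed.

(** At the index j the chain (i, n - 2 i, i) is cut, since the coefficient
n - 2 j - 1 of u(j+1, n-2j-2, j+1) vanishes; the zero obtained there propagates down
to i = 0 as long as the i + 1 are invertible. *)
Lemma diagonal_zero j : (2 * j < n)%N -> (n - (2 * j).+1)%:R = 0 :> k ->
  (forall i, (i <= j)%N -> i.+1%:R != 0 :> k) -> u 0 n 0 = 0.
Proof.
move=> jn nj0 inv.
have down i : (i <= j)%N -> u (j - i) (n - 2 * (j - i)) (j - i) = 0.
  elim: i => [|i IH] ij.
    apply: (@cancel (2 * j.+1%:R)); first by apply: mulf_neq0; last exact: inv.
    have := uE (a := j.+1) (b := (n - (2 * j).+1)%N) (c := j) ltac:(lia).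
    rewrite nj0 mul0r subn0 /=.
    by rewrite (_ : (n - (2 * j).+1).+1 = n - 2 * j)%N //; lia.
  set x := (j - i.+1)%N; have xE : (j - i = x.+1)%N by rewrite /x; lia.
  have := IH (ltnW ij); rewrite xE => IHx.
  apply: (@cancel (2 * x.+1%:R)); first by apply: mulf_neq0; last by apply: inv; lia.
  have := uE (a := x.+1) (b := (n - (2 * x).+1)%N) (c := x) ltac:(lia).
  rewrite (_ : (n - (2 * x).+1).-1 = n - 2 * x.+1)%N; last by lia.
  rewrite IHx mulr0 /=.
  by rewrite (_ : (n - (2 * x).+1).+1 = n - 2 * x)%N //; lia.
by have := down j (leqnn j); rewrite subnn muln0 subn0.
Qed.
End Coinvariants.

(** * Invariants of the Frobenius kernel are killed by the Lie algebra *)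

Definition dual_numbers (k : fieldType) : comAlgType k := {poly %/ ('X^2 : {poly k})}.
Definition eps (k : fieldType) : dual_numbers k := in_qpoly 'X^2 'X.

Lemma eps_sqr (k : fieldType) : eps k ^+ 2 = 0.
Proof.
rewrite /eps -rmorphXn /=; apply: val_inj; rewrite /= mk_monic_Xn.
by rewrite Pdiv.RingMonic.rmodpp // monicXn.
Qed.

Lemma eps_neq0 (k : fieldType) : eps k != 0.
Proof.
apply/eqP => /(congr1 val) /=.
rewrite mk_monic_Xn Pdiv.Ring.rmodp_small ?size_polyX ?size_polyXn //.
by move/eqP; rewrite polyX_eq0.
Qed.

Section Pairing.
Variables (k : fieldType) (n : nat) (v : 'cV[k]_#|{: monomial 3 n}|).

(** The value at x^m of the linear form with coordinates v, extended by zero to the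
monomials whose degree is not n. *)
Definition vcoef (m : 'X_{1..3}) : k := \sum_b (m == expnt b)%:R * v b 0.

Lemma vcoefE b : vcoef (expnt b) = v b 0.
Proof.
rewrite /vcoef (bigD1 b) //= eqxx mul1r big1 ?addr0 // => c cb.
by rewrite eq_sym (inj_eq (@expnt_inj 3 n)) (negPf cb) mul0r.
Qed.

(** The linear form with coordinates v after extension of scalars from k to R. *)
Definition pairing (R : comAlgType k) (s : {mpoly R[3]}) : R :=
  \sum_b s@_(expnt b) * (v b 0)%:A.

Lemma pairingX (R : comAlgType k) m :
  pairing ('X_[m] : {mpoly R[3]}) = (vcoef m)%:A.
Proof.
rewrite /pairing /vcoef scaler_suml; apply: eq_bigr => b _.
by rewrite mcoeffX; case: eqP; rewrite ?mul1r ?mul0r ?scale0r.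
Qed.

Lemma pairingD (R : comAlgType k) (s t : {mpoly R[3]}) :
  pairing (s + t) = pairing s + pairing t.
Proof.
rewrite /pairing -big_split; apply: eq_bigr => b _.
by rewrite mcoeffD mulrDl.
Qed.

Lemma pairingZ (R : comAlgType k) c (s : {mpoly R[3]}) :
  pairing (c *: s) = c * pairing s.
Proof.
by rewrite /pairing mulr_sumr; apply: eq_bigr => b _; rewrite mcoeffZ mulrA.
Qed.

Lemma G1_invariant_pairing p (R : comAlgType k) (g : 'M[R]_2) m :
  @G1_invariant k p (Dsl2 k n%:Z) v -> G1 p g -> mdeg m = n ->
  pairing (mpoly_comp_mx (sl2_act g) 'X_[m]) = pairing 'X_[m].
Proof.
move=> vinv gG /expntP[a <-]; have /matrixP/(_ a 0) := vinv R g gG.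
rewrite mxE [RHS]mxE pairingX vcoefE => E; apply: etrans E.
by apply: eq_bigr => b _; rewrite /= !mxE.
Qed.

End Pairing.

Lemma expr_eps (R : comNzRingType) (e x y : R) i : e ^+ 2 = 0 ->
  (x + e * y) ^+ i = x ^+ i + e * (i%:R * x ^+ i.-1 * y).
Proof.
move=> e2; elim: i => [|i IH]; first by rewrite !mul0r mulr0 addr0.
rewrite exprS IH; case: i {IH} => [|i] /=.
  by rewrite !expr0 expr1; ring.
transitivity (x ^+ i.+2 + e * (i.+2%:R * x ^+ i.+1 * y) +
  e ^+ 2 * (i.+1%:R * x ^+ i * y ^+ 2)); last by rewrite e2 mul0r addr0.
by rewrite !exprS -[i.+2%:R]natr1; ring.
Qed.

(** First order expansions of the actions of 1 + eps e and 1 + eps f; the coefficients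
of eps are the derivations by which e and f act. *)
Lemma comp_ad_upper (R : comNzRingType) (e : R) a b c : e ^+ 2 = 0 ->
  mpoly_comp_mx (ad_mx 1 e 0 1) 'X_[mnm3 a b c] = 'X_[mnm3 a b c] +
    e *: (- (2 * a%:R) *: 'X_[mnm3 a.-1 b.+1 c] + b%:R *: 'X_[mnm3 a b.-1 c.+1]).
Proof.
move=> e2; have E2 : (e%:MP : {mpoly R[3]}) ^+ 2 = 0.
  by rewrite -rmorphXn /= e2 mpolyC0.
rewrite mpoly_comp_mxX prod3 !mnmE /= !big3 !mxE /= e2 -!mul_mpolyC !mpolyX3.
rewrite !(rmorph_nat, mpolyC0, mpolyC1, rmorphN, rmorphD, rmorphM) /=.
rewrite !(rmorph_nat, expr1n, mpolyC1, mpolyC0, mulr1, mul1r, oppr0, mul0r, mulr0,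
  addr0, add0r).
rewrite (_ : 'X_0 + _ = 'X_0 + e%:MP * (- 2 * 'X_1)); last by ring.
rewrite !expr_eps // !exprS; apply/eqP; rewrite -subr_eq0.
rewrite [X in X == 0](_ : _ = e%:MP ^+ 2 * (a%:R * 'X_0 ^+ a.-1 * (- 2 * 'X_1) *
  (b%:R * 'X_1 ^+ b.-1 * 'X_2) * 'X_2 ^+ c)); first by rewrite E2 mul0r.
ring.
Qed.

Lemma comp_ad_lower (R : comNzRingType) (e : R) a b c : e ^+ 2 = 0 ->
  mpoly_comp_mx (ad_mx 1 0 e 1) 'X_[mnm3 a b c] = 'X_[mnm3 a b c] +
    e *: (- b%:R *: 'X_[mnm3 a.+1 b.-1 c] + (2 * c%:R) *: 'X_[mnm3 a b.+1 c.-1]).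
Proof.
move=> e2; have E2 : (e%:MP : {mpoly R[3]}) ^+ 2 = 0.
  by rewrite -rmorphXn /= e2 mpolyC0.
rewrite mpoly_comp_mxX prod3 !mnmE /= !big3 !mxE /= e2 -!mul_mpolyC !mpolyX3.
rewrite !(rmorph_nat, mpolyC0, mpolyC1, rmorphN, rmorphD, rmorphM) /=.
rewrite !(rmorph_nat, expr0n, expr1n, mpolyC1, mpolyC0, mulr1, mul1r, oppr0, mul0r,
  mulr0, addr0, add0r).
rewrite (_ : - e%:MP * 'X_0 + _ = 'X_1 + e%:MP * (- 'X_0)); last by ring.
rewrite (_ : _ * 'X_1 + 'X_2 = 'X_2 + e%:MP * (2 * 'X_1)); last by ring.
rewrite !expr_eps // !exprS; apply/eqP; rewrite -subr_eq0.
rewrite [X in X == 0](_ : _ = e%:MP ^+ 2 * ('X_0 ^+ a * (b%:R * 'X_1 ^+ b.-1 * - 'X_0) *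
  (c%:R * 'X_2 ^+ c.-1 * (2 * 'X_1)))); first by rewrite E2 mul0r.
ring.
Qed.

(** Since eps^2 = 0 and p > 2, the elements 1 + eps e and 1 + eps f lie in the
Frobenius kernel. *)
Lemma G1_unipotent (R : comNzRingType) p (e : R) :
  (2 < p)%N -> e ^+ 2 = 0 ->
  G1 p (\matrix_(i, j) nth 0 (nth [::] [:: [:: 1; e]; [:: 0; 1]] i) j : 'M_2) /\
  G1 p (\matrix_(i, j) nth 0 (nth [::] [:: [:: 1; 0]; [:: e; 1]] i) j : 'M_2).
Proof.
move=> p2 e2; have ep : e ^+ p = 0.
  by rewrite -(subnK (ltnW p2)) exprD e2 mulr0.
have p0 : (p == 0)%N = false by lia.
by split; split; rewrite /SL2 ?det_mx22E ?mxE /= ?mulr0 ?mul0r ?subr0 ?mulr1 //;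
  apply/matrixP => -[[|[|]] // i2] [[|[|]] // j2]; rewrite !mxE /= ?expr1n ?ep ?expr0n ?p0.
Qed.

Section Infinitesimal.
Variables (k : fieldType) (p n : nat).
Hypothesis p_gt2 : (2 < p)%N.
Variable v : 'cV[k]_#|{: monomial 3 n}|.
Hypothesis vinv : @G1_invariant k p (Dsl2 k n%:Z) v.
Let u a b c := vcoef v (mnm3 a b c).

Lemma eps_scale_eq0 (c : k) : c *: eps k = 0 -> c = 0.
Proof. by move/eqP; rewrite scaler_eq0 (negPf (eps_neq0 k)) orbF => /eqP. Qed.

Local Notation in_alg := GRing.in_alg.
Let R := dual_numbers k.
Let e := eps k.

Let pairing_eps (x y : k) m m1 m2 :
  pairing v ('X_[m] + e *: ((in_alg R x) *: 'X_[m1] + (in_alg R y) *: 'X_[m2])) =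
    pairing v ('X_[m] : {mpoly R[3]}) ->
  x * vcoef v m1 + y * vcoef v m2 = 0.
Proof.
rewrite pairingD pairingZ pairingD !pairingZ !pairingX => /eqP.
rewrite -subr_eq0 addrAC subrr add0r -![(vcoef v _)%:A]/(in_alg R _).
rewrite -!rmorphM -rmorphD /= mulr_algr => /eqP; exact: eps_scale_eq0.
Qed.

Lemma G1_invariant_raise a b c : (a + b + c = n)%N ->
  2 * a%:R * u a.-1 b.+1 c = b%:R * u a b.-1 c.+1.
Proof.
move=> abc; have [gG _] := G1_unipotent p_gt2 (eps_sqr k).
have := G1_invariant_pairing vinv gG (m := mnm3 a b c).
rewrite mdeg_mnm3 => /(_ abc); rewrite sl2_actE !mxE /= comp_ad_upper ?eps_sqr //.
rewrite -!(rmorph_nat (in_alg R)) -rmorphM -rmorphN => /pairing_eps E.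
by apply/eqP; rewrite eq_sym -subr_eq0 -mulNr addrC; exact/eqP.
Qed.

Lemma G1_invariant_lower a b c : (a + b + c = n)%N ->
  2 * c%:R * u a b.+1 c.-1 = b%:R * u a.+1 b.-1 c.
Proof.
move=> abc; have [_ gG] := G1_unipotent p_gt2 (eps_sqr k).
have := G1_invariant_pairing vinv gG (m := mnm3 a b c).
rewrite mdeg_mnm3 => /(_ abc); rewrite sl2_actE !mxE /= comp_ad_lower ?eps_sqr //.
rewrite -!(rmorph_nat (in_alg R)) -rmorphM -rmorphN => /pairing_eps E.
by apply/eqP; rewrite -subr_eq0 -mulNr addrC; exact/eqP.
Qed.

End Infinitesimal.

(** * The invariants as a Frobenius twist *)

Lemma base_change_mul (k : fieldType) (R : comAlgType k) m n q
  (A : 'M[k]_(m, n)) (B : 'M[k]_(n, q)) :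
  base_change R (A *m B) = base_change R A *m base_change R B.
Proof. exact: map_mxM. Qed.

Lemma G1_invariantB (k : fieldType) p (M : gmodule k) (v w : 'cV[k]_(gdim M)) :
  G1_invariant p v -> G1_invariant p w -> G1_invariant p (v - w).
Proof.
move=> hv hw R g gG; rewrite /base_change map_mxB mulmxBr.
by congr (_ - _); [exact: hv|exact: hw].
Qed.

(** An equivariant map sends a module with trivial action of the Frobenius kernel
into the invariants. *)
Lemma equivariant_G1_invariant (k : fieldType) p (M N : gmodule k)
    (f : 'M[k]_(gdim M, gdim N)) (u : 'cV[k]_(gdim N)) :
  equivariant f -> (forall (R : comAlgType k) (g : 'M[R]_2), G1 p g ->
    gact N g = 1%:M) -> G1_invariant p (f *m u).
Proof.
move=> feq N1 R g gG; rewrite base_change_mul mulmxA -feq; last by case: gG.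
by rewrite (N1 R g gG) mulmx1.
Qed.

Section Residues.
Variables (k : fieldType) (p : nat).
Hypothesis charp : p \in [pchar k].

Lemma natr_eq0_dvd m : (m%:R == 0 :> k) = (p %| m)%N.
Proof. by rewrite (dvdn_pcharf charp). Qed.

Lemma natr_eq_mod a c : a%:R = c%:R :> k -> (a %% p = c %% p)%N.
Proof.
wlog ac : a c / (c <= a)%N => [W E|].
  by case: (leqP c a) => [|/ltnW] ca; [exact: W|symmetry; apply: W].
move/eqP; rewrite -subr_eq0 -natrB // natr_eq0_dvd -eqn_mod_dvd //.
by move/eqP.
Qed.

Lemma natr_eqN1_mod b : b%:R = -1 :> k -> (b %% p = p.-1)%N.
Proof.
move=> /eqP; rewrite -addr_eq0 natr1 natr_eq0_dvd => /dvdnP[t E].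
have p0 := prime_gt0 (pcharf_prime charp).
case: t E => // t; rewrite mulSn => E.
have -> : b = (t * p + p.-1)%N by lia.
by rewrite modnMDl modn_small // ltn_predL.
Qed.

End Residues.

(** The degree fixes the residue of a = c.  With al this residue, the degree equation
reads 2 (al + i + 1) = s p, where 0 < al + i + 1 < 2 p; as p is odd, s = 2.
Here M stands for m + 1, which allows the case m = -1. *)
Lemma section_residues p i M a b c : odd p -> (i < p)%N ->
  (i * 2 + (a + b + c) + p = M * p + 3 * p.-1)%N ->
  (a %% p = c %% p)%N -> (b %% p = p.-1)%N ->
  [/\ (a %% p = p.-1 - i)%N, (c %% p = p.-1 - i)%N &
      (a %/ p + b %/ p + c %/ p).+1 = M].
Proof.
move=> oddp ip; have p0 : (0 < p)%N by lia.
rewrite {1}(divn_eq a p) {1}(divn_eq b p) {1}(divn_eq c p).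
have := ltn_pmod a p0.
move: (a %/ p)%N (b %/ p)%N (c %/ p)%N (a %% p)%N (b %% p)%N (c %% p)%N.
move=> a' b' c' al be ga al_p E al_ga be_p.
have {}E : (2 * (al + i).+1 + (a' + b' + c').+1 * p = (M + 2) * p)%N.
  by rewrite be_p -al_ga in E; nia.
have [s Es] : exists s, (M + 2 = (a' + b' + c').+1 + s)%N.
  exists (M + 2 - (a' + b' + c').+1)%N; apply/esym/subnKC.
  by rewrite -(leq_pmul2r p0) -E leq_addl.
have {}E : (2 * (al + i).+1 = s * p)%N.
  by move: E; rewrite Es mulnDl; lia.
have s2 : s = 2%N.
  case: s E {Es} => [|[|[|[|s]]]] E //; try nia;
  by move: (congr1 odd E); rewrite !oddM oddp.
by subst s; rewrite -al_ga; split; lia.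
Qed.

Lemma pchar_odd (k : fieldType) p : p \in [pchar k] -> (2 < p)%N -> odd p.
Proof. by move=> /pcharf_prime/even_prime[->|]. Qed.

Lemma two_neq0 (k : fieldType) p : p \in [pchar k] -> (2 < p)%N -> 2 != 0 :> k.
Proof. by move=> charp p2; rewrite (natr_eq0_dvd charp 2) gtnNdvd. Qed.

Lemma G1_invariant_zero (k : fieldType) p n (v : 'cV[k]_#|{: monomial 3 n}|) :
  p \in [pchar k] -> (2 < p)%N -> @G1_invariant k p (Dsl2 k n%:Z) v ->
  (forall a b c, (a + b + c = n)%N -> b%:R = -1 :> k -> a%:R = c%:R :> k ->
     vcoef v (mnm3 a b c) = 0) ->
  vcoef v (mnm3 0 n 0) = 0 -> v = 0.
Proof.
move=> charp p2 vinv hv h0; apply/matrixP => a z; rewrite ord1 mxE -vcoefE.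
rewrite [expnt a]mnm3P.
have abc : (expnt a 0%R + expnt a 1%R + expnt a 2%R = n)%N.
  by rewrite -mdeg_mnm3 -mnm3P mdeg_expnt.
exact: (determined_by_section (two_neq0 charp p2)
  (u := fun a b c => vcoef v (mnm3 a b c))
  (G1_invariant_raise p2 vinv) (G1_invariant_lower p2 vinv)).
Qed.

Section Determination.
Variables (k : fieldType) (p i n M : nat).
Hypothesis charp : p \in [pchar k].
Hypothesis p_gt2 : (2 < p)%N.
Hypothesis i_lt : (i < p)%N.
Hypothesis deg_eq : (i * 2 + n + p = M * p + 3 * p.-1)%N.

(** As M is m + 1, the condition is empty for M = 0, that is for D^(-1) = 0. *)
Definition vanishes_on_sections (v : 'cV[k]_#|{: monomial 3 n}|) :=
  forall b, (mdeg b).+1 = M -> vcoef v (section_mnm p i b) = 0.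

Lemma vcoef_section_zero v a b c : vanishes_on_sections v ->
  (a + b + c = n)%N -> b%:R = -1 :> k -> a%:R = c%:R :> k ->
  vcoef v (mnm3 a b c) = 0.
Proof.
move=> hv abc /(natr_eqN1_mod charp) bE /(natr_eq_mod charp) acE.
have E : (i * 2 + (a + b + c) + p = M * p + 3 * p.-1)%N by rewrite abc.
have [aE cE ME] := section_residues (pchar_odd charp p_gt2) i_lt E acE bE.
have -> : mnm3 a b c = section_mnm p i (mnm3 (a %/ p) (b %/ p) (c %/ p)).
  by rewrite /section_mnm mnm3M mnm3D -{1}aE -cE -bE -!divn_eq.
by apply: hv; rewrite mdeg_mnm3.
Qed.

(** The second alternative provides the place j where the chain starting at x1^n is
cut; in the first one x1^n is itself one of the section monomials. *)
Definition diagonal_condition := (n%:R = -1 :> k) \/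
  exists2 j, (2 * j < n)%N && (j < p.-1)%N & (p %| n - (2 * j).+1)%N.

Lemma diagonal_vanishes v : @G1_invariant k p (Dsl2 k n%:Z) v ->
  vanishes_on_sections v -> diagonal_condition -> vcoef v (mnm3 0 n 0) = 0.
Proof.
move=> vinv hv [nE|[j /andP[jn jp] dv]]; first by apply: vcoef_section_zero; rewrite ?addn0.
apply: (diagonal_zero (two_neq0 charp p_gt2) (u := fun a b c => vcoef v (mnm3 a b c))
   (G1_invariant_raise p_gt2 vinv) jn).
  by apply/eqP; rewrite (natr_eq0_dvd charp).
move=> l lj; rewrite (natr_eq0_dvd charp) gtnNdvd //; lia.
Qed.

Lemma G1_invariant_eq0 v : @G1_invariant k p (Dsl2 k n%:Z) v ->
  vanishes_on_sections v -> diagonal_condition -> v = 0.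
Proof.
move=> vinv hv hd; apply: (G1_invariant_zero charp p_gt2 vinv); last exact: diagonal_vanishes.
by move=> a b c; exact: vcoef_section_zero.
Qed.

End Determination.

Lemma frob_G1 (k : fieldType) p (charp : p \in [pchar k]) (N : gmodule k)
    (R : comAlgType k) (g : 'M[R]_2) : G1 p g -> gact (gtwist N charp) g = 1%:M.
Proof. by case=> _ g1; rewrite /= /twist_act g1 gact1. Qed.

Lemma mdeg_section_mnm p i b : (i < p)%N ->
  (mdeg (section_mnm p i b) + i * 2 = mdeg b * p + 3 * p.-1)%N.
Proof. by move=> ip; rewrite /section_mnm mdegD mdegMn mdeg_mnm3; lia. Qed.

Lemma trace_mx_section (k : fieldType) p i n m q (u : 'M[k]_(_, q)) a b z :
  (i < p)%N -> expnt a = section_mnm p i (expnt b) ->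
  (trace_mx k p i n m *m u) a z = u b z.
Proof.
move=> ip aE; rewrite mxE (bigD1 b) //= big1 => [|c cb].
  by rewrite mxE aE trace_section // eqxx mul1r addr0.
by rewrite mxE aE trace_section // (inj_eq (@expnt_inj 3 m)) eq_sym (negPf cb) mul0r.
Qed.

(** The coordinates of an invariant at the section monomials give its preimage: the
difference with the image of this candidate is an invariant that vanishes there. *)
Lemma trace_iso (k : fieldType) p (charp : p \in [pchar k]) i n m :
  (2 < p)%N -> (i < p)%N -> (i * 2 + n = m * p + 3 * p.-1)%N ->
  diagonal_condition k p n ->
  G1_invariants_iso p (Dsl2 k n%:Z) (gtwist (Dsl2 k m%:Z) charp).
Proof.
move=> p2 ip deg_eq diag.
have section_row b : mdeg b = m -> exists a : 'I_#|{: monomial 3 n}|,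
    expnt a = section_mnm p i b.
  by move=> bm; apply: expntP; have := mdeg_section_mnm b ip; rewrite bm; lia.
have feq := trace_mx_equivariant charp deg_eq.
have finv (u : 'cV[k]_(gdim (gtwist (Dsl2 k m%:Z) charp))) :
    @G1_invariant k p (Dsl2 k n%:Z) (trace_mx k p i n m *m u).
  exact: (equivariant_G1_invariant u feq (@frob_G1 k p charp (Dsl2 k m%:Z))).
exists (trace_mx k p i n m); split=> [//|u u' E|v].
  apply/matrixP => b z; have [a aE] := section_row _ (mdeg_expnt b).
  by rewrite -(trace_mx_section u z ip aE) E (trace_mx_section u' z ip aE).
split=> [vinv|[u ->]]; last exact: finv.
exists (\col_b vcoef v (section_mnm p i (expnt b))); set u := \col_b _.
apply/eqP; rewrite -subr_eq0; apply/eqP.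
apply: (@G1_invariant_eq0 k p i n m.+1 charp p2 ip) => //; first by lia.
  exact: G1_invariantB.
move=> b [bm]; have [a aE] := section_row _ bm; have [b0 b0E] := expntP bm.
rewrite -aE vcoefE 2!mxE (trace_mx_section (b := b0) u 0 ip); last by rewrite b0E.
by rewrite mxE -vcoefE aE b0E subrr.
Qed.

Lemma zero_iso (k : fieldType) p (charp : p \in [pchar k]) i n :
  (2 < p)%N -> (i < p)%N -> (i * 2 + n + p = 3 * p.-1)%N ->
  diagonal_condition k p n ->
  G1_invariants_iso p (Dsl2 k n%:Z) (gtwist (gtriv k 0) charp).
Proof.
move=> p2 ip deg_eq diag; exists 0; split=> [R g _|u u' _|v].
- by rewrite /base_change map_mx0 mul0mx mulmx0.
- by apply/matrixP => -[].
split=> [vinv|[u ->] R g _]; last by rewrite mul0mx /base_change map_mx0 mulmx0.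
exists 0; rewrite mulmx0.
by apply: (@G1_invariant_eq0 k p i n 0 charp p2 ip).
Qed.

(** * Small even degrees *)

(** The constant coefficient operator given by the quadratic form dual to omega. *)
Definition laplacian (R : comNzRingType) (s : {mpoly R[3]}) : {mpoly R[3]} :=
  mderiv 1 (mderiv 1 s) + 4 *: mderiv 2 (mderiv 0 s).

Lemma mpoly_comp_mx_mulr (R : comNzRingType) d (A : 'M[R]_d) s t :
  mpoly_comp_mx A (s * t) = mpoly_comp_mx A s * mpoly_comp_mx A t.
Proof. exact: rmorphM. Qed.

Lemma mpoly_ring_ind (R : comNzRingType) d (P : {mpoly R[d]} -> Prop) :
  (forall c, P c%:MP) -> (forall i, P 'X_i) ->
  (forall s t, P s -> P t -> P (s + t)) -> (forall s t, P s -> P t -> P (s * t)) ->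
  forall s, P s.
Proof.
move=> PC PX PD PM; elim/mpolyind => [|c m s _ _ Ps]; first by rewrite -mpolyC0.
apply: (PD) => //; rewrite -mul_mpolyC; apply: (PM) => //; rewrite mpolyXE_id.
apply: (big_ind P) => [||i _]; [by rewrite -mpolyC1|exact: PM|].
elim: (m i) => [|e IH]; first by rewrite expr0 -mpolyC1.
by rewrite exprS; exact: PM.
Qed.

(** The chain rule for a linear substitution. *)
Lemma mderiv_comp_mx (R : comNzRingType) d (A : 'M[R]_d) j s :
  mderiv j (mpoly_comp_mx A s) = \sum_i A i j *: mpoly_comp_mx A (mderiv i s).
Proof.
elim/mpoly_ring_ind: s => [c|l|s t IHs IHt|s t IHs IHt].
- rewrite /mpoly_comp_mx comp_mpolyC mderivC big1 // => i _.
  by rewrite mderivC comp_mpoly0 scaler0.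
- have dX (i i' : 'I_d) : mderiv i' ('X_i : {mpoly R[d]}) = (i == i')%:R%:MP.
    rewrite mderivX mnm1E; case: eqP => [->|_]; last by rewrite scale0r mpolyC0.
    by rewrite -{1}[U_(i')%MM]add0m addmK mpolyX0 scale1r mpolyC1.
  rewrite mpoly_comp_mxXU raddf_sum /= (bigD1 j) //= [RHS](bigD1 l) //=.
  rewrite !big1 => [|i|i]; rewrite ?mderivZ !dX /mpoly_comp_mx ?comp_mpolyC.
  - by rewrite !eqxx.
  - by rewrite eq_sym => /negPf->; rewrite mpolyC0 scaler0.
  by move=> /negPf ->; rewrite mpolyC0 scaler0.
- rewrite /mpoly_comp_mx !(comp_mpolyD, mderivD) IHs IHt -big_split /=.
  by apply: eq_bigr => i _; rewrite mderivD comp_mpolyD scalerDr.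
rewrite mpoly_comp_mx_mulr mderivM IHs IHt mulr_suml mulr_sumr -big_split /=.
apply: eq_bigr => i _; rewrite mderivM /mpoly_comp_mx comp_mpolyD scalerDr.
by rewrite -!/(mpoly_comp_mx _ _) !mpoly_comp_mx_mulr scalerAl scalerAr.
Qed.

(** Ad(g) preserves omega up to the factor det(g)^2, hence also the dual form. *)
Lemma laplacian_ad_mx (R : comNzRingType) (a b c d : R) s :
  laplacian (mpoly_comp_mx (ad_mx a b c d) s) =
  (a * d - b * c) ^+ 2 *: mpoly_comp_mx (ad_mx a b c d) (laplacian s).
Proof.
set A := ad_mx a b c d.
have compD s' t : mpoly_comp_mx A (s' + t) = mpoly_comp_mx A s' + mpoly_comp_mx A t.
  exact: comp_mpolyD.
have compZ x t : mpoly_comp_mx A (x *: t) = x *: mpoly_comp_mx A t.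
  exact: comp_mpolyZ.
rewrite /laplacian !mderiv_comp_mx !big3 !mderivD !mderivZ !mderiv_comp_mx !big3.
rewrite !compD !compZ.
rewrite !(mderiv_comm 0 1 s) !(mderiv_comm 0 2 s) !(mderiv_comm 1 2 s).
move: (mpoly_comp_mx A (mderiv 0 (mderiv 0 s))) (mpoly_comp_mx A (mderiv 0 (mderiv 1 s))).
move: (mpoly_comp_mx A (mderiv 0 (mderiv 2 s))) (mpoly_comp_mx A (mderiv 1 (mderiv 1 s))).
move: (mpoly_comp_mx A (mderiv 1 (mderiv 2 s))) (mpoly_comp_mx A (mderiv 2 (mderiv 2 s))).
move=> s12 s22 s02 s11 s00 s01.
rewrite !mxE /= -!mul_mpolyC.
rewrite !(rmorphN, rmorphB, rmorphD, rmorphM, rmorphXn, rmorph_nat) /=.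
ring.
Qed.

Definition laplacian_value (R : comNzRingType) h (s : {mpoly R[3]}) : R :=
  (iter h (@laplacian R) s)@_0%MM.

Lemma laplacian_is_linear (R : comNzRingType) c (s t : {mpoly R[3]}) :
  laplacian (c *: s + t) = c *: laplacian s + laplacian t.
Proof.
rewrite /laplacian !(mderivD, mderivZ) scalerDr -!mul_mpolyC; ring.
Qed.

Lemma laplacian_value_linear (R : comNzRingType) h (x : R) s t :
  laplacian_value h (x *: s + t) = x * laplacian_value h s + laplacian_value h t.
Proof.
rewrite /laplacian_value; elim: h s t => [|h IH] s t; first by rewrite mcoeffD mcoeffZ.
by rewrite !iterSr laplacian_is_linear IH.
Qed.

Lemma laplacian_value0 (R : comNzRingType) h :
  laplacian_value h (0 : {mpoly R[3]}) = 0.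
Proof.
have := laplacian_value_linear h 1 0 (0 : {mpoly R[3]}).
by rewrite scaler0 addr0 mul1r => /eqP; rewrite -subr_eq subrr eq_sym => /eqP.
Qed.

Lemma laplacian_value_sum (R : comNzRingType) h (I : Type) (r : seq I) (c : I -> R)
    (s : I -> {mpoly R[3]}) :
  laplacian_value h (\sum_(i <- r) c i *: s i) =
  \sum_(i <- r) c i * laplacian_value h (s i).
Proof.
elim: r => [|i r IH]; first by rewrite !big_nil laplacian_value0.
by rewrite !big_cons laplacian_value_linear IH.
Qed.

Lemma mcoeff0_comp_mx (R : comNzRingType) d (A : 'M[R]_d) s :
  (mpoly_comp_mx A s)@_0%MM = s@_0%MM.
Proof.
elim/mpoly_ring_ind: s => [c|l|s t IHs IHt|s t IHs IHt].
- by rewrite /mpoly_comp_mx comp_mpolyC.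
- rewrite mpoly_comp_mxXU (dhomog_nemf_coeff (d := 1) (mf := mdeg)) ?mdeg0 //.
    by rewrite mcoeffX mnm1_eq0.
  by apply: rpred_sum => j _; apply: rpredZ; rewrite dhomogX /= mdeg1.
  by rewrite /= mdeg0.
- have -> : mpoly_comp_mx A (s + t) = mpoly_comp_mx A s + mpoly_comp_mx A t.
    exact: comp_mpolyD.
  by rewrite !mcoeffD IHs IHt.
by rewrite mpoly_comp_mx_mulr !rmorphM /= IHs IHt.
Qed.

Lemma laplacian_value_ad_mx (R : comNzRingType) h (a b c d : R) s :
  a * d - b * c = 1 ->
  laplacian_value h (mpoly_comp_mx (ad_mx a b c d) s) = laplacian_value h s.
Proof.
move=> det1; rewrite /laplacian_value; elim: h s => [|h IH] s.
  exact: mcoeff0_comp_mx.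
by rewrite !iterSr laplacian_ad_mx det1 expr1n scale1r IH.
Qed.

Lemma map_laplacian_value (R S : comNzRingType) (f : {rmorphism R -> S}) h s :
  laplacian_value h (map_mpoly f s) = f (laplacian_value h s).
Proof.
have map_mderiv i (t : {mpoly R[3]}) : mderiv i (map_mpoly f t) = map_mpoly f (mderiv i t).
  by apply/mpolyP => m; rewrite !(mcoeff_deriv, mcoeff_map_mpoly) raddfMn.
rewrite /laplacian_value; elim: h s => [|h IH] s; first by rewrite /= mcoeff_map_mpoly.
rewrite !iterSr -IH; congr (mcoeff _ (iter _ _ _)).
by rewrite /laplacian !map_mderiv rmorphD /= map_mpolyZ rmorph_nat.
Qed.

Lemma laplacian_value_diagonal (R : comNzRingType) h :
  laplacian_value h ('X_[mnm3 0 (2 * h) 0] : {mpoly R[3]}) = (2 * h)`!%:R.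
Proof.
rewrite /laplacian_value; elim: h => [|h IH].
  rewrite muln0 fact0 /= mcoeffX (_ : mnm3 0 0 0 = 0%MM) ?eqxx //.
  by apply/mnmP => -[[|[|[|]]] i3] //; rewrite !mnmE.
rewrite iterSr (_ : laplacian _ = ((2 * h).+2 * (2 * h).+1)%:R *: 'X_[mnm3 0 (2 * h) 0]).
  rewrite -[_ *: _]addr0 -/(laplacian_value h _) laplacian_value_linear.
  rewrite laplacian_value0 addr0 [laplacian_value _ _]IH.
  by rewrite -natrM -mulnA -!factS mulnS.
have d0 : mderiv 0 ('X_[mnm3 0 (2 * h.+1) 0] : {mpoly R[3]}) = 0.
  by rewrite mderivX mnmE scale0r.
rewrite /laplacian d0 mderiv0 scaler0 addr0 mderivX mderivZ mderivX scalerA -natrM.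
rewrite mnmBE mnm1E mnmE /= mulnS add2n subn1.
congr (_ *: 'X_[_]).
by apply/mnmP => -[[|[|[|]]] i3] //; rewrite !mnmE /=; lia.
Qed.

Lemma prime_ndvd_fact p n : prime p -> (n < p)%N -> ~~ (p %| n`!)%N.
Proof.
move=> pr_p; elim: n => [|n IH] np; first by rewrite fact0 dvdn1 neq_ltn prime_gt1 ?orbT.
by rewrite factS Euclid_dvdM // negb_or IH ?(ltnW np) // gtnNdvd.
Qed.

(** Monomials of degree n < p - 1 never have exponent -1 modulo p at x1, so an
invariant is determined by its value at x1^n; on the Laplacian form this value is n!,
a unit as n < p. *)
Lemma trivial_iso (k : fieldType) p (charp : p \in [pchar k]) n :
  (2 < p)%N -> (n <= p - 3)%N -> ~~ odd n ->
  G1_invariants_iso p (Dsl2 k n%:Z) (gtriv k 1).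
Proof.
move=> p2 np nodd; set h := (n./2)%N.
have nE : (2 * h)%N = n by rewrite mul2n even_halfK.
pose f : 'M[k]_(#|{: monomial 3 n}|, 1) :=
  \matrix_(a, b) laplacian_value h 'X_[expnt a].
have feq : @equivariant k (gtriv k 1) (Dsl2 k n%:Z) f.
  move=> R g det_g; rewrite /= /triv_act mulmx1; apply/matrixP => a z.
  have fE c z' : base_change R f c z' = laplacian_value h 'X_[expnt c].
    by rewrite !mxE -map_laplacian_value map_mpolyX.
  rewrite fE mxE.
  rewrite -(@laplacian_value_ad_mx R h (g 0 0) (g 0 1) (g 1 0) (g 1 1)); last first.
    exact: SL2_entries.
  rewrite -sl2_actE.
  have := mpoly_comp_mx_homog (sl2_act g) (expnt a).
  rewrite mdeg_expnt => /dhomog_expntE {1}->; rewrite laplacian_value_sum.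
  by apply: eq_bigr => c _; rewrite fE mxE.
have finv (u : 'cV[k]_(gdim (gtriv k 1))) : @G1_invariant k p (Dsl2 k n%:Z) (f *m u).
  exact: (equivariant_G1_invariant u feq (fun _ _ _ => erefl)).
have [d dE] : exists d : 'I_#|{: monomial 3 n}|, expnt d = mnm3 0 n 0.
  by apply: expntP; rewrite mdeg_mnm3 addn0.
have fd z : f d z != 0.
  rewrite mxE dE -{1}nE laplacian_value_diagonal nE (natr_eq0_dvd charp).
  by rewrite prime_ndvd_fact ?(pcharf_prime charp) //; lia.
have fu (u : 'cV[k]_1) z : (f *m u) d z = f d 0 * u 0 z.
  by rewrite mxE big_ord1.
exists f; split=> [//|u u' E|v].
  apply/matrixP => b z; rewrite [b]ord1; apply: (mulfI (fd 0)).
  by rewrite -!fu E.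
split=> [vinv|[u ->]]; last exact: finv.
exists (\col__ (v d 0 / f d 0)); set u := \col__ _.
apply/eqP; rewrite -subr_eq0; apply/eqP.
apply: (G1_invariant_zero charp p2).
- exact: G1_invariantB.
- move=> a b c abc /(natr_eqN1_mod charp) bE _; have := leq_mod b p; lia.
by rewrite -dE vcoefE 2!mxE fu [u 0 0]mxE [f d 0 * _]mulrC divfK // subrr.
Qed.

Theorem theorem6p5 (k : fieldType) (p : nat) (charp : p \in [pchar k])
  (p_gt2 : (2 < p)%N) (n q r : nat) (n_def : n = (q * p + r)%N)
  (r_lt_p : (r < p)%N) :
  [/\ (n <= p - 3)%N -> ~~ odd n ->
        G1_invariants_iso p (Dsl2 k n%:Z) (gtriv k 1),
      r = (p - 1)%N ->
        G1_invariants_iso p (Dsl2 k n%:Z) (gtwist (Dsl2 k q%:Z) charp),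
      odd r ->
        G1_invariants_iso p (Dsl2 k n%:Z) (gtwist (Dsl2 k (q%:Z - 1)) charp)
    & (r < p - 1)%N -> ~~ odd r -> (1 <= q)%N ->
        G1_invariants_iso p (Dsl2 k n%:Z) (gtwist (Dsl2 k (q%:Z - 2)) charp)].
Proof.
have oddp := pchar_odd charp p_gt2.
split=> [|rE|rodd|r_lt reven q_gt0]; first exact: trivial_iso.
- apply: (@trace_iso k p charp p.-1) => //; try by lia.
  (* Here n = -1 in k. *)
  left; apply/eqP; rewrite -addr_eq0 natr1 (natr_eq0_dvd charp).
  by apply/dvdnP; exists q.+1; lia.
- (* The cut is where n - 2 j - 1 = q p, that is 2 j + 1 = r. *)
  have diag : diagonal_condition k p n.
    right; exists r./2; first by lia.
    by apply/dvdnP; exists q; lia.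
  (* For q = 0 the target is D^(-1) = 0, reached with m = -1. *)
  case: q n_def => [|q] n_def.
    by apply: (@zero_iso k p charp (p.-1 - (r./2).+1)) => //; lia.
  rewrite -[q.+1]addn1 PoszD addrK.
  by apply: (@trace_iso k p charp (p.-1 - (r./2).+1)) => //; lia.
(* As r is even, the cut is at 2 j + 1 = r + p, which needs q > 0. *)
have diag : diagonal_condition k p n.
  have half : (2 * (r + p)./2).+1 = (r + p)%N by lia.
  have qp : (q * p = q.-1 * p + p)%N by rewrite -mulSnr prednK.
  right; exists ((r + p)./2); first by lia.
  by apply/dvdnP; exists q.-1; rewrite half n_def qp -addnA [(p + r)%N]addnC addnK.
(* For q = 1 the target is D^(-1) = 0, reached with m = -1. *)
case: q n_def q_gt0 => [//|[|q]] n_def _.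
  by apply: (@zero_iso k p charp ((p - 3 - r)./2)) => //; lia.
rewrite -[q.+2]addn2 PoszD addrK.
by apply: (@trace_iso k p charp ((p - 3 - r)./2)) => //; lia.
Qed.
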